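(* Let $X$ be a compact Riemann surface with an automorphism $\tau$ of order $p$ such that the genus of $X/\langle\tau\rangle$ is zero. Let $P_{1,1},\dots,P_{1,n_1},\dots,P_{r,1},\dots,P_{r,n_r}$ be all the branched points of $\tau$ (i.e. of the natural projection $X\to X/\langle\tau\rangle$), where for each $i$ the points $P_{i,1},\dots,P_{i,n_i}$ form one $\langle\tau\rangle$-orbit, distinct $i$ giving distinct orbits, and let the rotation numbers be $\mathcal R_\tau(P_{i,l})=\mathcal R(n_i,k_i)$ for all $i$ and $l$. For each $i$ let $m_i$ be the unique integer with $1\le m_i<p$, $\gcd(p,m_i)=n_i$ and $k_i\cdot\frac{m_i}{n_i}\equiv 1 \pmod{\frac{p}{n_i}}$. Let $\Psi: X/\langle\tau\rangle\to\hat{\mathbb C}$ be an isomorphism such that $a_i:=\Psi([P_{i,1}])\in\mathbb C$ for all $i$. Then an equation of $X$ is $$y^p=\prod_{i=1}^r (x-a_i)^{m_i},$$ and $\tau$ corresponds to the automorphism $(x,y)\mapsto(x,\zeta_p y)$ of this curve; that is, there is an isomorphism $\Phi$ from $X$ onto the compact Riemann surface defined by this equation such that $\Phi\circ\tau\circ\Phi^{-1}$ is $(x,y)\mapsto (x,\zeta_p y)$.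
   Context: Equation of a compact Riemann surface: for an irreducible polynomial $F(x,y)=\sum_{i=0}^p a_i(x)y^i\in\mathbb C[x,y]$ with $p\ge 1$, there is a compact Riemann surface $X_F$, unique up to isomorphism, containing $\{(x,y)\in\mathbb C^2: F(x,y)=0,\ F_y(x,y)\neq 0,\ a_p(x)\ne 0\}$ as the complement of finitely many points, such that $(x,y)\mapsto x$ extends holomorphically to $X_F\to\hat{\mathbb C}$. Saying that $F(x,y)=0$ is an equation of $X$ means that $F$ is irreducible and $X$ is isomorphic to $X_F$. $\zeta_p$ is a fixed primitive $p$-th root of unity, and for a divisor $n$ of $p$ we set $\zeta_{p/n}=\zeta_p^{\,n}$. Rotation number: let $\tau$ be an automorphism of order $p$ of a Riemann surface $X$ and $P\in X$. Let $n$ be the smallest natural number with $\tau^n(P)=P$, and let $\varphi$ be a $\tau^n$-invariant chart around $P$ centered at the origin, so that $\varphi\circ\tau^n\circ\varphi^{-1}(t)=\zeta_{p/n}^{\,k}\,t$ for a unique integer $k$ with $0\le k<\frac pn$. (The number $k$ is independent of the chart.) The rotation number of $\tau$ at $P$ is the pair $(n,k)$, written $\mathcal R_\tau(P)=\mathcal R(n,k)$. It is the same at all points of a $\langle\tau\rangle$-orbit. *)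

(* Defs.v *)
From HB Require Import structures.
From mathcomp Require Export all_boot all_order all_algebra.
From mathcomp Require Export complex.
From mathcomp Require Export all_classical all_reals.
From mathcomp Require Export topology normedtype derive.

Set Implicit Arguments.
Unset Strict Implicit.
Unset Printing Implicit Defensive.

Import Order.TTheory GRing.Theory Num.Theory.
Export numFieldNormedType.Exports.

Local Open Scope classical_set_scope.
Local Open Scope ring_scope.
Local Open Scope quotient_scope.

(* Going through numClosedFieldType gives C its norm topology and makes
   [derivable f z 1] complex differentiability of f : C -> C at z. *)
Definition cplx (R : realType) : numClosedFieldType := R[i].
Arguments cplx : simpl never.

Section RiemannSurfaces.
Variable R : realType.
Local Notation C := (cplx R).

(* [cmap] matters only on [cdom], and [cinv] only on [cmap @` cdom]. *)
Record chart (T : Type) := Chart {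
  cdom : set T;
  cmap : T -> C;
  cinv : C -> T }.

Definition is_chart (T : topologicalType) (c : chart T) : Prop :=
  [/\ open (cdom c),
      open (cmap c @` cdom c),
      forall x, cdom c x -> cinv c (cmap c x) = x,
      forall x, cdom c x -> {for x, continuous (cmap c)}
    & forall x, cdom c x -> {for cmap c x, continuous (cinv c)}].

Definition compatible (T : Type) (c d : chart T) : Prop :=
  forall x, cdom c x -> cdom d x ->
    derivable (cmap d \o cinv c) (cmap c x) 1 /\
    derivable (cmap c \o cinv d) (cmap d x) 1.

(* A space with a chosen set of charts; the axioms of a Riemann surface are
   the predicate [riemann_surface]. *)
Record cspace := CSpace {
  carrier :> topologicalType;
  atlas : set (chart carrier) }.

Arguments atlas : clear implicits.

Definition riemann_surface (X : cspace) : Prop :=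
  [/\ hausdorff_space X,
      connected [set: X] /\ [set: X] !=set0,
      (forall c, atlas X c -> is_chart c),
      (forall x : X, exists2 c, atlas X c & cdom c x)
    & (forall c d, atlas X c -> atlas X d -> compatible c d)].

Definition compact_riemann_surface (X : cspace) : Prop :=
  riemann_surface X /\ compact [set: X].

(* Membership in the maximal atlas. *)
Definition holo_chart (X : cspace) (c : chart X) : Prop :=
  is_chart c /\ forall d, atlas X d -> compatible c d.

Definition cdiff_at (X Y : cspace) (f : X -> Y) (x : X) : Prop :=
  {for x, continuous f} /\
  forall c d, atlas X c -> atlas Y d -> cdom c x -> cdom d (f x) ->
    derivable (cmap d \o f \o cinv c) (cmap c x) 1.

Definition holomorphic (X Y : cspace) (f : X -> Y) : Prop :=
  forall x, cdiff_at f x.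

Definition inverse_isos (X Y : cspace) (f : X -> Y) (g : Y -> X) : Prop :=
  [/\ holomorphic f, holomorphic g, cancel f g & cancel g f].

Definition isomorphism (X Y : cspace) (f : X -> Y) : Prop :=
  exists g : Y -> X, inverse_isos f g.

Definition plane : cspace :=
  @CSpace C [set Chart setT id id].

(* [None] is the point at infinity. *)
Definition sphere_T : topologicalType := one_point_compactification C.

Definition sphere_chart0 : chart sphere_T :=
  @Chart sphere_T [set~ None] (fun w => if w is Some z then z else 0) Some.

Definition sphere_chartoo : chart sphere_T :=
  @Chart sphere_T [set~ Some 0] (fun w => if w is Some z then z^-1 else 0)
    (fun z => if z == 0 then None else Some z^-1).

Definition sphere : cspace :=
  @CSpace sphere_T [set sphere_chart0; sphere_chartoo].

(* A holomorphic 1-form f_c(z) dz is given by its coefficients: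
   [w c x] is f_c at the point z = cmap c x. *)
Definition holo_form (X : cspace) (w : chart X -> X -> C) : Prop :=
  (forall c x, atlas X c -> cdom c x ->
     derivable (w c \o cinv c) (cmap c x) 1) /\
  (forall c d x, atlas X c -> atlas X d -> cdom c x -> cdom d x ->
     w c x = w d x * 'D_1 (cmap d \o cinv c) (cmap c x)).

(* The genus: the dimension of the space of holomorphic 1-forms. *)
Definition has_genus (X : cspace) (g : nat) : Prop :=
  exists e : 'I_g -> chart X -> X -> C,
    (forall i, holo_form (e i)) /\
    (forall w, holo_form w -> exists! a : 'rV[C]_g,
       forall c x, atlas X c -> cdom c x ->
         w c x = \sum_(i < g) a 0 i * e i c x).

Definition has_order (T : Type) (tau : T -> T) (p : nat) : Prop :=
  [/\ (0 < p)%N,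
      iter p tau =1 id
    & forall j, (0 < j < p)%N -> ~ iter j tau =1 id].

(* For tau of finite order, this is the orbit under the group <tau>. *)
Definition iorbit (T : Type) (tau : T -> T) (x : T) : set T :=
  [set iter j tau x | j in [set: nat]].

Section Quotient.
Variables (X : cspace) (tau : X -> X).

Definition same_orbit : rel X :=
  fun x y => `[< iorbit tau x = iorbit tau y >].

Lemma same_orbit_equiv : equiv_class_of same_orbit.
Proof.
split.
- by move=> x; apply/asboolP.
- by move=> x y; apply/asboolP/asboolP => ->.
- by move=> y x z /asboolP xy /asboolP yz; apply/asboolP; rewrite xy.
Qed.

Definition same_orbit_rel : equiv_rel X := EquivRelPack same_orbit_equiv.

Definition orbit_T : topologicalType :=
  quotient_topology {eq_quot same_orbit_rel}.

Definition orbit_pi (x : X) : orbit_T := \pi_(orbit_T) x.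

(* The complex structure of X/<tau>: a chart of the quotient topology is
   holomorphic iff its composite with the projection is. *)
Definition orbit_space : cspace :=
  @CSpace orbit_T
    [set c | is_chart c /\
       forall x, cdom c (orbit_pi x) ->
         @cdiff_at X plane (cmap c \o orbit_pi) x].

Definition orbit_proj (x : X) : orbit_space := orbit_pi x.

End Quotient.

(* x is a branched point of f iff f is not injective near x. *)
Definition branched_point (X Y : cspace) (f : X -> Y) (x : X) : Prop :=
  ~ exists2 U : set X, nbhs x U & set_inj U f.

(* R_tau(P) = R(n, k), with respect to the p-th root of unity [zeta]. *)
Definition rotation_number (X : cspace) (p : nat) (zeta : C) (tau : X -> X)
    (P : X) (n k : nat) : Prop :=
  [/\ (0 < n)%N,
      iter n tau P = P,
      forall j, (0 < j < n)%N -> iter j tau P <> P,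
      (k < p %/ n)%N
    & exists c : chart X,
        [/\ holo_chart c, cdom c P, cmap c P = 0,
            iter n tau @` cdom c = cdom c
          & forall x, cdom c x ->
              cmap c (iter n tau x) = (zeta ^+ n) ^+ k * cmap c x]].

(* F : {poly {poly C}} stands for sum_i a_i(x) y^i: the outer variable is y
   and the coefficients are polynomials in x. *)

Definition eval2 (F : {poly {poly C}}) (x y : C) : C := F.[y%:P].[x].

(* Irreducibility in C[x,y]; MathComp's [irreducible_poly] over {poly C} would
   ignore factors in C[x]. *)
Definition irreducible2 (F : {poly {poly C}}) : Prop :=
  [/\ F != 0, F \isn't a GRing.unit
    & forall G H : {poly {poly C}}, F = G * H ->
        G \is a GRing.unit \/ H \is a GRing.unit].

Section CurveModel.
Variable F : {poly {poly C}}.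

Definition affine_set : set (C * C) :=
  [set s | [/\ eval2 F s.1 s.2 = 0,
               eval2 F^`() s.1 s.2 != 0
             & (lead_coef F).[s.1] != 0]].

Definition affine_T : topologicalType := set_type affine_set.

Definition affine_pt (s : affine_T) : C * C := set_val s.

(* F_y <> 0 on this set, so x is a local coordinate: the charts are the
   restrictions of x to the open sets where it is a chart. *)
Definition affine_curve : cspace :=
  @CSpace affine_T
    [set c | is_chart c /\ forall s, cdom c s -> cmap c s = (affine_pt s).1].

(* (Y, iota) is a model of X_F, the compact Riemann surface containing the
   affine set as the complement of finitely many points; these conditions
   determine it up to isomorphism. *)
Definition is_surface_of (Y : cspace) (iota : affine_curve -> Y) : Prop :=
  [/\ compact_riemann_surface Y,
      holomorphic iota,
      exists g : Y -> affine_curve,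
        cancel iota g /\ forall s, cdiff_at g (iota s),
      finite_set (~` range iota)
    & exists2 xi : Y -> sphere,
        holomorphic xi & forall s, xi (iota s) = Some (affine_pt s).1].

Definition is_equation (X : cspace) : Prop :=
  [/\ (1 < size F)%N, irreducible2 F
    & exists (Y : cspace) (iota : affine_curve -> Y),
        is_surface_of iota /\ exists f : X -> Y, isomorphism f].

End CurveModel.

Definition cyclic_poly (p r : nat) (a : 'I_r -> C) (m : 'I_r -> nat) :
    {poly {poly C}} :=
  'X^p - (\prod_(i < r) ('X - (a i)%:P) ^+ m i)%:P.

End RiemannSurfaces.

Arguments atlas {R} X _ : rename.

(* Main.v *)
(* Let x = Psi o pi : X -> C u {oo} and f(x) = prod_i (x - a_i)^(m_i). A
   continuous y : X \ x^-1(oo) -> C with y o tau = zeta y and y^p = f(x)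
   identifies the complement of finitely many points of X with the affine curve
   y^p = f(x), its inverse being holomorphic because Psi is an isomorphism.
   Over a domain of the plane two such y differ by a locally constant p-th root
   of unity, so the local solutions glue over rectangles, hence over the whole
   plane. Local solutions exist: near an unbranched fibre any branch of
   f(x)^(1/p) spreads along orbits, and at P_{i,l}, in a chart t rotated by
   tau^n with multiplier w, the power t^(p/n) is a chart of the quotient, so
   x - a_i = t^(p/n) u with u invariant and nonzero, and
   y = t^(m/n) (u^m ...)^(1/p) works because w^(m/n) = zeta^n.
   Irreducibility of y^p - f(x) follows from the connectedness of X. *)
Require Import Defs.
From mathcomp Require Import separation_axioms zify lra.

Set Implicit Arguments.
Unset Strict Implicit.
Unset Printing Implicit Defensive.

Import Order.TTheory GRing.Theory Num.Theory.

Local Open Scope classical_set_scope.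
Local Open Scope ring_scope.

(** * Connectedness and real induction *)

(** [X] itself serves as the compact model of the curve, embedded by the inverse of Q |-> (x(Q),
    y(Q)); hence no compactification is built and y need not be controlled over infinity. Continuity
    of y suffices: where F_y is nonzero the charts of the curve are x alone, so holomorphy in both
    directions is a statement about x, while y only selects a point in a fibre. The obstacle is to
    obtain y without Cauchy theory or power series. Local roots come from factoring X^p - s over C,
    and the nonvanishing factor u of x - a_i comes from a difference quotient, continuous with a
    nonzero value at the centre because the quotient coordinate has a differentiable inverse. The
    comparison of two solutions by their p-th powers breaks down over the a_i, where y vanishes;
    hence finitely many points have to be deleted from connected sets, in the plane for uniqueness
    and on [X] for irreducibility. *)

Section RealInduction.
Variable R : realType.

(** The supremum of the endpoints reachable from [a] is itself reachable by the local hypothesis,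
    and the same hypothesis would carry past it if it lay below [b]. *)
Lemma interval_additive_ind (Pr : R -> R -> Prop) (a b : R) : a <= b ->
  (forall x, a <= x <= b -> exists2 e, 0 < e &
     forall s t, x - e < s -> s <= x -> x <= t -> t < x + e -> Pr s t) ->
  (forall s t u, s <= t -> t <= u -> Pr s t -> Pr t u -> Pr s u) ->
  Pr a b.
Proof.
move=> ab loc add.
pose E := [set t | a <= t <= b /\ Pr a t].
have Ea : E a.
  split; first by rewrite lexx ab.
  have [|e e0 He] := loc a; first by rewrite lexx.
  by apply: He; rewrite ?lexx// ?ltrBlDr ltrDl.
have supE : has_sup E by split; [exists a | exists b => t [/andP[]]].
set c := sup E.
have ac : a <= c by apply: sup_upper_bound.
have cb : c <= b by apply: ge_sup; [exists a|move=> t [/andP[]]].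
have [|e e0 He] := loc c; first by rewrite ac cb.
have [s [/andP[as_ sb] Pas] cs] := sup_adherent e0 supE.
have sc : s <= c by apply: sup_upper_bound => //; split => //; rewrite as_.
have ext t : c <= t -> t < c + e -> Pr a t.
  move=> ct te; apply: (add _ s) => //; first exact: le_trans ct.
  exact: He.
move: cb; rewrite le_eqVlt => /orP[/eqP <-|cb]; first by apply: ext => //; rewrite ltrDl.
exfalso.
(* Half of [e] keeps [t] strictly inside the local radius; [b - c] keeps it in the interval. *)
pose t := c + Num.min (e / 2) (b - c).
have mpos : 0 < Num.min (e / 2) (b - c) by rewrite lt_min divr_gt0//= subr_gt0.
have : t <= c; last by rewrite /t gerDl leNgt mpos.
apply: sup_upper_bound => //; split.
  apply/andP; split; first by apply: le_trans ac _; rewrite lerDl ltW.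
  by rewrite /t -lerBrDl ge_min lexx orbT.
apply: ext; first by rewrite lerDl ltW.
rewrite /t ltrD2l gt_min; apply/orP; left.
by rewrite ltr_pdivrMr// ltr_pMr// ltr1n.
Qed.

End RealInduction.

(** * Deleting finitely many points from a connected open set *)

Section ConnectedRemove.
Variable T : topologicalType.
Hypothesis hT : hausdorff_space T.

(** True at the points of a surface and false on a line: this is what allows a point to be deleted
    without disconnecting its surroundings. *)
Definition locally_punctured_connected (x : T) := forall U, nbhs x U ->
  exists V, [/\ nbhs x V, V `<=` U & connected (V `\ x)].

(** For a relatively clopen part [B] of the punctured set, a small connected [V \ s] lies in [B] or
    misses it. In the first case [B] together with [s] is clopen in [D], which gives the claim; in
    the second [B] is clopen in [D], so it equals [D] and contains [s], a contradiction. *)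
Lemma connectedD1 (D : set T) (s : T) : open D -> connected D ->
  locally_punctured_connected s -> connected (D `\ s).
Proof.
move=> oD cD ls.
have cls : closed [set s] by apply/accessible_closed_set1/hausdorff_accessible.
have [Ds|Ds] := pselect (D s); last by rewrite not_setD1.
have [V [sV VD cV]] := ls D (open_nbhs_nbhs (conj oD Ds)).
have clV : closed (~` V°) by apply: open_closedC; exact: open_interior.
move=> B B0 [U oU BU] [K cK BK].
have BE : B `<=` D `\ s by rewrite BU => ? [].
have [VB|VB] := pselect ((V `\ s) `&` B !=set0).
  have VsB : V `\ s `<=` B.
    have -> : V `\ s = (V `\ s) `&` B.
      apply/esym/cV => //.
        exists U => //; rewrite BU setIA; congr (_ `&` _).
        by apply/setIidl => z [/VD Dz zs].
      exists K => //; rewrite BK setIA; congr (_ `&` _).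
      by apply/setIidl => z [/VD Dz zs].
    by move=> z [].
  have E : B `|` [set s] = D.
    apply: cD; first by exists s; right.
      exists (U `|` V°); first by apply: openU => //; exact: open_interior.
      apply/seteqP; split => z.
        case=> [|->]; last by split => //; right.
        by rewrite BU => -[[Dz zs] Uz]; split => //; left.
      case=> Dz zUV; have [->|zs] := pselect (z = s); first by right.
      left; case: zUV => [Uz|/interior_subset Vz]; last by apply: VsB; split.
      by rewrite BU; split => //; split.
    exists (K `|` [set s]); first exact: closedU.
    apply/seteqP; split => z.
      case=> [|->]; last by split => //; right.
      by rewrite BK => -[[Dz zs] Uz]; split => //; left.
    case=> Dz [Kz|->]; last by right.
    have [->|zs] := pselect (z = s); first by right.
    by left; rewrite BK; split => //; split.
  apply/seteqP; split => // z [Dz zs].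
  by move: Dz; rewrite -E => -[].
have BD : B = D.
  apply: cD => //.
    exists (U `&` ~` [set s]); first by apply: openI => //; exact: closed_openC.
    apply/seteqP; split => z; rewrite BU; first by case=> -[Dz zs] Uz.
    by case=> Dz [Uz zs].
  exists (K `&` ~` V°); first exact: closedI.
  apply/seteqP; split => z.
    move=> Bz; have := BE z Bz; rewrite {1}BK in Bz; case: Bz => -[Dz zs] Kz _.
    split => //; split => // /interior_subset Vz; apply: VB; exists z; split => //.
    by rewrite BK.
  case=> Dz [Kz Vz]; rewrite BK; split => //; split => // zs.
  by apply: Vz; rewrite zs.
by have := Ds; rewrite -{1}BD => /BE[_ /(_ erefl)].
Qed.

Lemma openD_finite (D S : set T) : open D -> finite_set S -> open (D `\` S).
Proof.
move=> oD fS; rewrite setDE; apply: openI => //; apply: closed_openC.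
by move: S fS; exact/accessible_finite_set_closed/hausdorff_accessible.
Qed.

Lemma connected_setD_finite (D S : set T) : open D -> connected D ->
  finite_set S -> (forall s, D s -> locally_punctured_connected s) ->
  connected (D `\` S).
Proof.
move=> oD cD fS ls.
have /finite_seqP[l ->] := fS.
elim: l => [|s l IH]; first by rewrite set_nil setD0.
have E : D `\` [set` s :: l] = (D `\` [set` l]) `\ s.
  apply/seteqP; split => z /=; rewrite in_cons.
    by case=> Dz /negP; rewrite negb_or => /andP[/eqP zs /negP zl].
  by case=> -[Dz /negP zl] /eqP zs; split=> //; apply/negP; rewrite negb_or zs.
rewrite E.
have oDl : open (D `\` [set` l]) by apply: openD_finite.
have [Ds|Ds] := pselect (D s); last by rewrite not_setD1 //= => -[].
by apply: connectedD1 => //; apply: ls.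
Qed.

End ConnectedRemove.

(** * Roots and difference quotients *)

Definition open_at (S T : topologicalType) (f : S -> T) (x : S) :=
  forall U, nbhs x U -> nbhs (f x) (f @` U).

(** Openness of [f] at [x] is continuity of its local inverse; [A] singles out the branch that [g]
    takes. *)
Lemma inverse_continuous_at (S T : topologicalType) (f : S -> T) (g : T -> S)
    (A : set S) (x : S) :
  open_at f x -> nbhs x A -> set_inj A f -> g (f x) = x ->
  (\forall y \near f x, A (g y) /\ f (g y) = y) -> {for f x, continuous g}.
Proof.
move=> of_ xA injf gfx gA W; rewrite /= gfx => xW.
have h : nbhs (f x) (f @` (W `&` A)) by apply: of_; exact: filterI.
suff : \forall y \near f x, W (g y) by [].
near=> y.
have [v [Wv Av] fv] : (f @` (W `&` A)) y by near: y.
have [Agy fgy] : A (g y) /\ f (g y) = y by near: y.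
rewrite (_ : g y = v)//.
by apply: injf; rewrite ?inE // fgy.
Unshelve. all: by end_near. Qed.

Lemma continuous_near_eq (S T : topologicalType) (f g : S -> T) x :
  {near x, f =1 g} -> {for x, continuous f} -> {for x, continuous g}.
Proof.
move=> fg fc W; rewrite /= -(nbhs_singleton fg) => /fc.
by move: fg; apply: filterS2 => y E; rewrite /preimage /= E.
Qed.

Section Powers.
Variable K : numClosedFieldType.

(** The product of |w - v| over the p roots v of X^p - s equals |w^p - s|, so the factors cannot all
    exceed its p-th root. Openness of powers and continuity of roots both rest on this bound. *)
Lemma exists_near_root (p : nat) (w s : K) : (0 < p)%N ->
  exists2 v, v ^+ p = s & `|w - v| ^+ p <= `|w ^+ p - s|.
Proof.
move=> p0.
have [r Er] := closed_field_poly_normal ('X^p - s%:P : {poly K}).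
rewrite lead_coefXnsubC// scale1r in Er.
have sr : size r = p.
  by have := size_XnsubC s p0; rewrite Er size_prod_XsubC => -[].
have rootr z : z \in r -> z ^+ p = s.
  rewrite -root_prod_XsubC -Er /root !hornerE subr_eq0; exact/eqP.
have [|H] := pselect (exists2 v, v \in r & `|w - v| ^+ p <= `|w ^+ p - s|).
  by case=> v /rootr; exists v.
exfalso.
have Hlt z : z \in r -> 0 <= `|w ^+ p - s| < `|w - z| ^+ p.
  move=> zr; rewrite normr_ge0/= real_ltNge ?rpredX ?normr_real//.
  by apply/negP => h; apply: H; exists z.
have E : `|w ^+ p - s| ^+ p = \prod_(z <- r) (`|w - z| ^+ p).
  rewrite prodrXl; congr (_ ^+ _).
  have := congr1 (fun q : {poly K} => `|q.[w]|) Er.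
  rewrite !hornerE horner_prod normr_prod => ->.
  by apply: eq_bigr => z _; rewrite !hornerE.
have : \prod_(z <- r) `|w ^+ p - s| < \prod_(z <- r) (`|w - z| ^+ p).
  rewrite big_seq_cond [ltRHS]big_seq_cond; apply: ltr_prod.
    case: (r) sr p0 => [<-//|z r' _ _ /=]; by rewrite mem_head.
  by move=> z; rewrite andbT; exact: Hlt.
by rewrite big_const_seq count_predT sr -E iter_mulr_1 ltxx.
Qed.

Lemma open_at_pow (p : nat) (w : K) : (0 < p)%N -> open_at (fun z : K => z ^+ p) w.
Proof.
move=> p0 U /nbhs_ballP[e /= e0 eU]; apply/nbhs_ballP; exists (e ^+ p).
  exact: exprn_gt0.
move=> s; rewrite -ball_normE /= => hs.
have [v vs hv] := exists_near_root w s p0.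
exists v => //; apply: eU; rewrite -ball_normE /=.
have := le_lt_trans hv hs.
by rewrite ltr_pXn2r// ?nnegrE// ltW.
Qed.

Lemma cvg_pow (T : Type) (F : set_system T) (FF : Filter F) (f : T -> K) (l : K) n :
  f @ F --> l -> (fun t => f t ^+ n) @ F --> l ^+ n.
Proof.
move=> fl; elim: n => [|n IH]; first by rewrite expr0; exact: cvg_cst.
rewrite exprS; under eq_fun do rewrite exprS; exact: cvgM.
Qed.

Lemma cvg_big_sum (T : Type) (F : set_system T) (FF : Filter F) n
    (f : 'I_n -> T -> K) (l : 'I_n -> K) :
  (forall i, f i @ F --> l i) ->
  (fun t => \sum_(i < n) f i t) @ F --> \sum_(i < n) l i.
Proof.
elim: n f l => [|n IH] f l fl.
  by rewrite big_ord0; under eq_fun do rewrite big_ord0; exact: cvg_cst.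
rewrite big_ord_recl; under eq_fun do rewrite big_ord_recl.
by apply: cvgD => //; apply: IH.
Qed.

Lemma cvg_big_prod (T : Type) (F : set_system T) (FF : Filter F) (I : Type)
    (s : seq I) (Pr : pred I) (f : I -> T -> K) (l : I -> K) :
  (forall i, f i @ F --> l i) ->
  (fun t => \prod_(i <- s | Pr i) f i t) @ F --> \prod_(i <- s | Pr i) l i.
Proof.
move=> fl; elim: s => [|i s IH].
  by rewrite big_nil; under eq_fun do rewrite big_nil; exact: cvg_cst.
rewrite big_cons; under eq_fun do rewrite big_cons.
by case: (Pr i) => //; exact: cvgM.
Qed.

Lemma cvg_horner (T : Type) (F : set_system T) (FF : Filter F) (f : T -> K)
    (l : K) (q : {poly K}) : f @ F --> l -> (fun t => q.[f t]) @ F --> q.[l].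
Proof.
move=> fl; rewrite horner_coef; under eq_fun do rewrite horner_coef.
apply: cvg_big_sum => i; apply: cvgM; [exact: cvg_cst|exact: cvg_pow].
Qed.

(** In the factorisation of f^p - g^p by f - g the cofactor tends to p w^(p-1), which is nonzero. *)
Lemma pow_inj_near (T : Type) (F : set_system T) (FF : Filter F) (f g : T -> K)
    (w : K) (p : nat) : (0 < p)%N -> w != 0 ->
  f @ F --> w -> g @ F --> w ->
  \forall t \near F, f t ^+ p = g t ^+ p -> f t = g t.
Proof.
move=> p0 w0 fw gw.
have : (fun t => \sum_(i < p) f t ^+ (p.-1 - i) * g t ^+ i) @ F -->
    \sum_(i < p) w ^+ (p.-1 - i) * w ^+ i.
  by apply: cvg_big_sum => i; apply: cvgM; apply: cvg_pow.
move=> /cvgr_neq0; rewrite (eq_bigr (fun=> w ^+ p.-1)); last first.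
  move=> i _; rewrite -exprD subnK//; have := ltn_ord i.
  by move: (nat_of_ord i) => j; rewrite -{1}(prednK p0) ltnS.
rewrite sumr_const card_ord -mulr_natr mulf_neq0 ?expf_neq0 ?pnatr_eq0 -?lt0n//.
move=> /(_ isT); apply: filterS => t nz /eqP.
rewrite -subr_eq0 subrXX mulf_eq0 (_ : (\sum_(i < _) _ == 0) = false) ?orbF ?subr_eq0.
  by move/eqP.
by apply/negbTE; exact: nz.
Qed.

Lemma pow_inj_nbhs (p : nat) (w : K) : (0 < p)%N -> w != 0 ->
  exists2 B, nbhs w B & forall u v, B u -> B v -> u ^+ p = v ^+ p -> u = v.
Proof.
move=> p0 w0.
have : \forall v \near (w, w), v.1 ^+ p = v.2 ^+ p -> v.1 = v.2.
  by apply: (@pow_inj_near _ (nbhs (w, w)) _ fst snd w); rewrite //;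
     [exact: cvg_fst|exact: cvg_snd].
case=> -[A B] /= [wA wB] AB; exists (A `&` B); first exact: filterI.
by move=> u v [Au _] [_ Bv]; exact: (AB (u, v)).
Qed.

Lemma local_root (p : nat) (w : K) : (0 < p)%N -> w != 0 ->
  exists (h : K -> K) (U : set K), open U /\ U w /\
    forall z, U z -> h z ^+ p = z /\ {for z, continuous h}.
Proof.
move=> p0 w0.
have [c cw _] := exists_near_root 0 w p0.
have c0 : c != 0 by apply: contra_neq w0 => c0; rewrite -cw c0 expr0n; case: p p0 {cw}.
have [B cB injB] := pow_inj_nbhs p0 c0.
have /nbhs_ballP[e /= e0 eB] := cB.
(* For each [z] a root close to [c] is chosen; for [z] near [w] all the choices fall in the ball
   where the p-th power is injective, and this forces continuity. *)
pose h z := projT1 (cid2 (exists_near_root c z p0)).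
have hp z : h z ^+ p = z by rewrite /h; case: cid2.
have hb z : `|c - h z| ^+ p <= `|c ^+ p - z| by rewrite /h; case: cid2.
have hball z : ball w (e ^+ p) z -> ball c e (h z).
  rewrite -!ball_normE /= -cw => /(le_lt_trans (hb z)).
  by rewrite ltr_pXn2r// ?nnegrE// ltW.
exists h, (ball w (e ^+ p)); split; first exact: ball_open.
split; first by apply: ballxx; exact: exprn_gt0.
move=> z wz; split => //.
have := @inverse_continuous_at _ _ (fun z : K => z ^+ p) h (ball c e) (h z).
rewrite hp; apply => //.
- exact: open_at_pow.
- apply: open_nbhs_nbhs; split; [exact: ball_open|exact: hball].
- by move=> u v; rewrite !inE => /eB Bu /eB Bv; exact: injB.
have : nbhs z (ball w (e ^+ p)).
  by apply: open_nbhs_nbhs; split => //; exact: ball_open.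
by apply: filterS => y /hball.
Qed.

Lemma nbhs_rotation_invariant (x : K) (U : set K) : nbhs x U ->
  exists B : set K, [/\ open B, B x, B `<=` U &
    forall w y z, `|w| = 1 -> z - x = w * (y - x) -> B y -> B z].
Proof.
move=> /nbhs_ballP[d /= d0 Hd]; exists (ball x d); split => //.
- exact: ball_open.
- exact: ballxx.
move=> w y z w1 E; rewrite -!ball_normE /= distrC => yd.
by rewrite distrC E normrM w1 mul1r.
Qed.

Lemma derivable_comp1 (f g : K -> K) z :
  derivable f z 1 -> derivable g (f z) 1 -> derivable (g \o f) z 1.
Proof.
move=> /derivable1_diffP hf /derivable1_diffP hg; apply/derivable1_diffP.
exact: differentiable_comp.
Qed.

Lemma derive_local_inverse_neq0 (f g : K -> K) z :
  derivable f z 1 -> derivable g (f z) 1 -> {near z, g \o f =1 id} ->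
  'D_1 f z != 0.
Proof.
move=> hf hg gf.
have df : differentiable f z by move/derivable1_diffP: hf.
have dg : differentiable g (f z) by move/derivable1_diffP: hg.
have : 'D_1 (g \o f) z = 1 by rewrite (near_eq_derive _ gf) derive_id.
rewrite deriveE; last exact: differentiable_comp.
rewrite diff_comp//= => h1.
have E : 'D_1 f z = 'd f z 1 by rewrite deriveE.
apply/eqP => h0.
rewrite E in h0.
have h2 := etrans (congr1 ('d g (f z)) h0) (linear0 _).
by have /eqP := etrans (esym h1) h2; rewrite oner_eq0.
Qed.

(** Filling in the derivative at [z] gives a factorisation f(s) - f(z) = (s - z) q(s) with q
    continuous, in place of a Taylor expansion. *)
Definition diff_quotient (f : K -> K) (z s : K) : K :=
  if s == z then 'D_1 f z else (f s - f z) / (s - z).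

Lemma diff_quotientP (f : K -> K) (z s : K) :
  f s - f z = (s - z) * diff_quotient f z s.
Proof.
rewrite /diff_quotient; have [->|sz] := eqVneq s z; first by rewrite !subrr mul0r.
by rewrite mulrC divfK// subr_eq0.
Qed.

Lemma diff_quotient_continuous (f : K -> K) (z : K) :
  derivable f z 1 -> {for z, continuous (diff_quotient f z)}.
Proof.
move=> hf W; rewrite /= {1}/diff_quotient eqxx => LW.
have := hf _ LW; rewrite /= => /nbhs_normP[d /= d0 Hd].
suff : \forall s \near z, W (diff_quotient f z s) by [].
apply/nbhs_normP; exists d => //= s sd.
have [->|sz] := eqVneq s z.
  by rewrite /diff_quotient eqxx; exact: nbhs_singleton LW.
have sz0 : s - z != 0 by rewrite subr_eq0.
have := Hd (s - z); rewrite /= sub0r normrN distrC => /(_ sd sz0).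
rewrite /diff_quotient (negbTE sz).
by rewrite /GRing.scale /= mulr1 subrK mulrC.
Qed.

Lemma diff_quotient_continuous_neq (f : K -> K) (z s : K) :
  {for s, continuous f} -> s != z -> {for s, continuous (diff_quotient f z)}.
Proof.
move=> fc sz.
have sz0 : s - z != 0 by rewrite subr_eq0.
have c1 : (fun x => f x - f z) @ s --> f s - f z.
  exact: (@cvgB K K K (nbhs s) _ f (fun=> f z) _ _ fc (cvg_cst _)).
have c2 : (fun x => x - z) @ s --> s - z.
  exact: (@cvgB K K K (nbhs s) _ id (fun=> z) _ _ cvg_id (cvg_cst _)).
have c3 : (fun x => (f x - f z) / (x - z)) @ s --> (f s - f z) / (s - z).
  exact: (@cvgM K K (nbhs s) _ _ _ _ _ c1 (@cvgV K K (nbhs s) _ _ _ sz0 c2)).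
apply: (@continuous_near_eq _ _ (fun x => (f x - f z) / (x - z))) c3.
have h : \forall x \near s, x - z != 0 by exact: (@cvgr_neq0 K K K (nbhs s) _ _ _ c2 sz0).
near=> x; rewrite /=.
have : x - z != 0 by near: x.
rewrite subr_eq0 /diff_quotient => /negbTE ->.
Unshelve. all: by end_near. Qed.
Lemma rotation_root p n k (z : K) : p.-primitive_root z -> (n %| p)%N ->
  coprime (p %/ n) k -> (p %/ n).-primitive_root ((z ^+ n) ^+ k).
Proof.
move=> hz np co; rewrite prim_root_exp_coprime 1?coprime_sym//.
have := dvdn_prim_root hz (dvdn_div np).
by rewrite divnA// mulKn// (prim_order_gt0 hz).
Qed.

Lemma prim_root1 : 1%N.-primitive_root (1 : K).
Proof.
apply/andP; split => //; apply/forallP => -[[|//] i1] /=.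
by rewrite unity_rootE expr1 !eqxx.
Qed.

Lemma prim_root_norm n (z : K) : n.-primitive_root z -> `|z| = 1.
Proof.
move=> hz; have zn := prim_expr_order hz; have n0 := prim_order_gt0 hz.
by apply/eqP; rewrite -(@pexpr_eq1 _ _ n) ?normr_ge0// -normrX zn normr1.
Qed.

End Powers.

(** * Rectangles in the complex plane *)

Section Rectangles.
Variable R : realType.
Local Notation C := (cplx R).

Definition re (z : C) : R := complex.Re z.
Definition im (z : C) : R := complex.Im z.
Definition of_real (t : R) : C := (t%:C)%C.

Lemma cplx_posE (e : C) : 0 < e -> e = ((re e)%:C)%C /\ 0 < re e.
Proof. by case: e => x y; rewrite ltcE /= => /andP[/eqP -> ->]. Qed.

Lemma continuous_re : continuous re.
Proof.
move=> z. apply/(@cvgrPdist_lt _ _ _ (nbhs z)) => e e0.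
have e0' : 0 < (e%:C)%C :> C by rewrite ltcR.
have : nbhs z (ball z ((e%:C)%C : C)) by exact: nbhsx_ballx.
apply: (@filterS _ (nbhs z)) => w; rewrite -ball_normE /=.
move/(le_lt_trans (normc_ge_Re _)); rewrite ltcR.
by case: (z) (w) => [? ?] [? ?].
Qed.

Lemma continuous_im : continuous im.
Proof.
move=> z; apply/(@cvgrPdist_lt _ _ _ (nbhs z)) => e e0.
have e0' : 0 < (e%:C)%C :> C by rewrite ltcR.
have : nbhs z (ball z ((e%:C)%C : C)) by exact: nbhsx_ballx.
apply: (@filterS _ (nbhs z)) => w; rewrite -ball_normE /=.
(* Multiplication by i turns the imaginary part into minus a real part, so the bound for real parts
   applies. *)
have := normc_ge_Re ((z - w : C) * 'i)%C.
rewrite ReiNIm normrN normrM [`|'i%C|]normc_def /= expr0n add0r expr1n sqrtr1 mulr1.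
move=> /le_lt_trans h /h; rewrite ltcR.
by case: (z) (w) => [? ?] [? ?].
Qed.

Lemma continuous_real_complex : continuous of_real.
Proof.
move=> t; apply/cvgrPdist_lt => e /cplx_posE[-> e0].
have : nbhs t (ball t (re e)) by exact: nbhsx_ballx.
apply: (@filterS _ (nbhs t)) => s; rewrite -ball_normE /=.
by rewrite /of_real -rmorphB normc_def /= expr0n addr0 sqrtr_sqr ltcR.
Qed.

Lemma cplx_norm_le (z : C) : `|z| <= ((`|re z| + `|im z|)%:C)%C.
Proof.
rewrite {1}(complexE z); apply: le_trans (ler_normD _ _) _.
rewrite normrM rmorphD; apply: lerD.
  by rewrite normc_def /= expr0n addr0 sqrtr_sqr.
by rewrite !normc_def /= expr0n add0r expr1n sqrtr1 mul1r addr0 sqrtr_sqr.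
Qed.

(** Rectangles are used rather than discs because two that overlap along a common strip have both a
    rectangular union and a rectangular, hence connected, intersection. *)
Definition rect (a b c d : R) : set C :=
  [set z | a < re z < b /\ c < im z < d].

Lemma open_rect a b c d : open (rect a b c d).
Proof.
have -> : rect a b c d = (re @^-1` `]a, b[) `&` (im @^-1` `]c, d[).
  by apply/seteqP; split => z; rewrite /rect /= !in_itv.
apply: openI; apply: open_comp; try exact: interval_open.
  by move=> z _; exact: continuous_re.
by move=> z _; exact: continuous_im.
Qed.

Lemma nbhs_rect (z : C) (U : set C) : nbhs z U ->
  exists2 e, 0 < e & rect (re z - e) (re z + e) (im z - e) (im z + e) `<=` U.
Proof.
move=> /nbhs_ballP[e /= /cplx_posE[-> e0] eU].
exists (re e / 2); first by rewrite divr_gt0.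
move=> w [/andP[h1 h2] /andP[h3 h4]]; apply: eU; rewrite -ball_normE /=.
apply: le_lt_trans (cplx_norm_le _) _; rewrite ltcR.
rewrite (_ : re (z - w) = re z - re w); last by case: (z) (w) => [? ?] [? ?].
rewrite (_ : im (z - w) = im z - im w); last by case: (z) (w) => [? ?] [? ?].
rewrite (splitr (re e)); apply: ltrD; rewrite ltr_norml; lra.
Qed.

(** By convexity, a rectangle is the union of the segments issuing from one of its points. *)
Lemma connected_rect a b c d : connected (rect a b c d).
Proof.
have [[z0 z0D]|/set0P/negP/negPn/eqP->] := pselect (rect a b c d !=set0); last first.
  exact: connected0.
pose g (z : C) (t : R) : C := z0 + of_real t * (z - z0).
have reg z t : re (g z t) = re z0 + t * (re z - re z0).
  by rewrite /g; case: (z) z0 {z0D g} => [? ?] [? ?] /=; rewrite mul0r subr0.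
have img z t : im (g z t) = im z0 + t * (im z - im z0).
  by rewrite /g; case: (z) z0 {z0D g reg} => [? ?] [? ?] /=; rewrite mul0r addr0.
have -> : rect a b c d = \bigcup_(z in rect a b c d) (g z @` `[0, 1]).
  apply/seteqP; split => [z zD|z [w [/andP[w1 w2] /andP[w3 w4]] [t /= + <-]]].
    exists z => //; exists 1; rewrite /= ?in_itv/= ?ler01 ?lexx//.
    by rewrite /g mul1r subrKC.
  move: z0D => [/andP[h1 h2] /andP[h3 h4]].
  rewrite in_itv /= => /andP[t0 t1].
  have conv (l u x y : R) : l < x < u -> l < y < u -> l < x + t * (y - x) < u.
    move=> /andP[lx xu] /andP[ly yu].
    move: t0; rewrite le_eqVlt => /orP[/eqP <-|t0]; first by rewrite mul0r addr0 lx.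
    by apply/andP; split; nra.
  by rewrite /rect /= reg img; split; apply: conv => //; apply/andP.
apply: bigcup_connected.
  exists z0 => z zD; exists 0; first by rewrite /= in_itv /= lexx ler01.
  by rewrite /g mul0r addr0.
move=> z zD; apply: connected_continuous_connected; first exact: segment_connected.
apply: continuous_subspaceT => t.
apply: cvgD; first exact: cvg_cst.
apply: cvgM; last exact: cvg_cst.
exact: continuous_real_complex.
Qed.

Lemma rect_punctured_connected (z : C) e : 0 < e ->
  connected (rect (re z - e) (re z + e) (im z - e) (im z + e) `\ z).
Proof.
move=> e0.
set x := re z; set y := im z.
(* Right, upper, left and lower halves: they cover everything but the centre, and each meets its
   predecessor in a quarter. *)
pose A1 := rect x (x + e) (y - e) (y + e).
pose A2 := rect (x - e) (x + e) y (y + e).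
pose A3 := rect (x - e) x (y - e) (y + e).
pose A4 := rect (x - e) (x + e) (y - e) y.
have -> : rect (x - e) (x + e) (y - e) (y + e) `\ z = A1 `|` A2 `|` A3 `|` A4.
  apply/seteqP; split => w.
    case=> -[/andP[h1 h2] /andP[h3 h4]] wz.
    have [h|h|h] := ltgtP x (re w).
    - by do 3 left; split; apply/andP; split.
    - by left; right; split; apply/andP; split.
    have [h'|h'|h'] := ltgtP y (im w).
    - by do 2 left; right; split; apply/andP; split.
    - by right; split; apply/andP; split.
    - exfalso; apply: wz; move: h h'; rewrite /x /y.
      by case: (w) (z) => [? ?] [? ?] /= -> ->.
  by do 3? [case] => -[/andP[h1 h2] /andP[h3 h4]]; (split;
    [split; apply/andP; split; lra|move=> wz; move: h1 h2 h3 h4; rewrite wz /x /y; lra]).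
have c1 : connected A1 by exact: connected_rect.
have c2 : connected A2 by exact: connected_rect.
have c3 : connected A3 by exact: connected_rect.
have c4 : connected A4 by exact: connected_rect.
have c12 : connected (A1 `|` A2).
  apply: connectedU => //; exists ((x + e / 2) +i* (y + e / 2))%C.
  by split; rewrite /A1 /A2 /rect /=; split; lra.
have c123 : connected (A1 `|` A2 `|` A3).
  apply: connectedU => //; exists ((x - e / 2) +i* (y + e / 2))%C.
  by split; [right|]; rewrite /A2 /A3 /rect /=; split; lra.
apply: connectedU => //; exists ((x - e / 2) +i* (y - e / 2))%C.
by split; [right|]; rewrite /A4 /A3 /rect /=; split; lra.
Qed.

Lemma nbhs_rect_center (z : C) e : 0 < e ->
  nbhs z (rect (re z - e) (re z + e) (im z - e) (im z + e)).
Proof.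
move=> e0; apply: open_nbhs_nbhs; split; first exact: open_rect.
by split; lra.
Qed.

Lemma cplx_locally_punctured_connected (z : C) : locally_punctured_connected z.
Proof.
move=> U /nbhs_rect[e e0 eU].
exists (rect (re z - e) (re z + e) (im z - e) (im z + e)); split => //.
  exact: nbhs_rect_center.
exact: rect_punctured_connected.
Qed.

End Rectangles.

(** * Charts and differentiable maps *)

Section Charts.
Variable R : realType.
Local Notation C := (cplx R).

Section OneChart.
Variables (T : topologicalType) (c : chart R T) (x : T).
Hypotheses (hc : is_chart c) (cx : cdom c x).

Lemma chart_near_inv :
  \forall z \near cmap c x, cdom c (cinv c z) /\ cmap c (cinv c z) = z.
Proof.
case: hc => _ oi ci _ _.
have : nbhs (cmap c x) (cmap c @` cdom c).
  by apply: open_nbhs_nbhs; split => //; exists x.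
by apply: filterS => z [y cy <-]; rewrite ci.
Qed.

Lemma chart_open_at : open_at (cmap c) x.
Proof.
case: (hc) => _ _ ci _ cont U xU.
have : nbhs (cmap c x) (cinv c @^-1` U) by apply: (cont x cx); rewrite ci.
move=> h; move: h chart_near_inv; apply: filterS2 => z Uz [_ E].
by exists (cinv c z).
Qed.

Lemma chart_nbhs : nbhs x (cdom c).
Proof. by case: hc => o _ _ _ _; exact: open_nbhs_nbhs. Qed.

Lemma chart_cinv_at : {for cmap c x, continuous (cinv c)}.
Proof. by case: hc => _ _ _ _; apply. Qed.

Lemma chart_cinvK : cinv c (cmap c x) = x.
Proof. by case: hc => _ _ + _ _; apply. Qed.

Lemma chart_cmap_at : {for x, continuous (cmap c)}.
Proof. by case: hc => _ _ _ + _; apply. Qed.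

End OneChart.

Lemma chart_inj (T : topologicalType) (c : chart R T) : is_chart c ->
  set_inj (cdom c) (cmap c).
Proof.
move=> hc x y; rewrite !inE => cx cy E.
by rewrite -(chart_cinvK hc cx) E chart_cinvK.
Qed.

(** The inverse is obtained by choice, with [x0] as its value off the image; its continuity is the
    openness of [phi]. *)
Lemma chart_of_open_inj (T : topologicalType) (U : set T) (phi : T -> C) (x0 : T) :
  open U -> set_inj U phi ->
  (forall x, U x -> {for x, continuous phi} /\ open_at phi x) ->
  exists psi, is_chart (Chart U phi psi).
Proof.
move=> oU injU phiP.
pose psi z := if pselect (exists2 x, U x & phi x = z) is left e
  then projT1 (cid2 e) else x0.
have psiP x : U x -> psi (phi x) = x.
  move=> Ux; rewrite /psi; case: pselect => [e|]; last by case; exists x.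
  by case: cid2 => y /= Uy E; apply: injU; rewrite ?inE.
have im z : (phi @` U) z -> U (psi z) /\ phi (psi z) = z.
  by case=> x Ux <-; rewrite psiP.
exists psi; split => //=.
- rewrite openE => z [x Ux <-]; rewrite /interior.
  by apply: (phiP x Ux).2; exact: open_nbhs_nbhs.
- by move=> x Ux; exact: (phiP x Ux).1.
move=> x Ux; apply: (@inverse_continuous_at _ _ _ _ U) => //.
- exact: (phiP x Ux).2.
- exact: open_nbhs_nbhs.
- exact: psiP.
have : nbhs (phi x) (phi @` U).
  by apply: (phiP x Ux).2; exact: open_nbhs_nbhs.
by apply: filterS => z; exact: im.
Qed.

(* The axioms of a surface used to compose differentiable maps: compatibility
   of the charts plays no role there. *)
Definition charted (X : cspace R) : Prop :=
  (forall c, atlas X c -> is_chart c) /\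
  (forall x : X, exists2 c, atlas X c & cdom c x).

Lemma riemann_surface_charted (X : cspace R) : riemann_surface X -> charted X.
Proof. by case. Qed.

Lemma charted_plane : charted (plane R).
Proof.
split=> [c ->|x]; last by exists (Chart setT id id).
split=> //=; rewrite ?image_id; try exact: openT.
  by move=> z _; exact: cvg_id.
by move=> z _; exact: cvg_id.
Qed.

Lemma cdiff_comp (X Y Z : cspace R) (f : X -> Y) (g : Y -> Z) (x : X) :
  charted X -> charted Y ->
  cdiff_at f x -> cdiff_at g (f x) -> cdiff_at (g \o f) x.
Proof.
move=> [cX _] [cY aY] [fc fd] [gc gd]; split; first exact: continuous_comp.
move=> c e ac ae cx efx.
have [d ad dfx] := aY (f x).
have h1 := fd c d ac ad cx dfx.
have h2 := gd d e ad ae dfx efx.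
have E : (cmap d \o f \o cinv c) (cmap c x) = cmap d (f x).
  by rewrite /= (chart_cinvK (cX _ ac) cx).
rewrite -E in h2.
have := derivable_comp1 h1 h2.
apply: near_eq_derivable.
(* The intermediate chart cancels only on its domain, so continuity of [f] is what makes the two
   composites agree near the point. *)
have : nbhs (cmap c x) ((f \o cinv c) @^-1` (cdom d)).
  apply: (@continuous_comp _ _ _ (cinv c) f).
  - exact: chart_cinv_at (cX _ ac) cx.
  - by rewrite (chart_cinvK (cX _ ac) cx).
  - by rewrite /= (chart_cinvK (cX _ ac) cx); exact: chart_nbhs (cY _ ad) dfx.
by apply: filterS => z dz /=; rewrite (chart_cinvK (cY _ ad) dz).
Qed.

Lemma cdiff_id (X : cspace R) (x : X) : riemann_surface X -> cdiff_at (@id X) x.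
Proof.
move=> [_ _ cX _ comp]; split; first exact: cvg_id.
by move=> c d ac ad cx dx; exact: (comp c d ac ad x cx dx).1.
Qed.

Lemma cdiff_iter (X : cspace R) (f : X -> X) n (x : X) : riemann_surface X ->
  holomorphic f -> cdiff_at (iter n f) x.
Proof.
move=> rX hf; elim: n x => [|n IH] x; first exact: cdiff_id.
have -> : iter n.+1 f = f \o iter n f by [].
by apply: cdiff_comp => //; exact: riemann_surface_charted.
Qed.

Lemma holo_chart_cdiff (X : cspace R) (c : chart R X) (x : X) :
  holo_chart c -> cdom c x -> @cdiff_at R X (plane R) (cmap c) x.
Proof.
move=> [hc comp] cx; split; first exact: chart_cmap_at.
by move=> d _ ad -> dx _; exact: (comp d ad x cx dx).2.
Qed.

Lemma atlas_holo_chart (X : cspace R) (c : chart R X) : riemann_surface X ->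
  atlas X c -> holo_chart c.
Proof. by move=> [_ _ cX _ comp] ac; split => [|d ad]; [exact: cX|exact: comp]. Qed.

Lemma plane_cdiff_comp (X : cspace R) (f : X -> C) (g : C -> C) (x : X) :
  charted X -> @cdiff_at R X (plane R) f x -> derivable g (f x) 1 ->
  @cdiff_at R X (plane R) (g \o f) x.
Proof.
move=> hX hf hg.
have hg' : @cdiff_at R (plane R) (plane R) g (f x).
  split; first by move/derivable1_diffP/differentiable_continuous: hg.
  by move=> _ _ -> -> _ _; exact: hg.
exact: (@cdiff_comp X (plane R) (plane R) f g x hX charted_plane hf hg').
Qed.

(** Carried over from the plane through a chart; it keeps [X] connected once the finitely many
    irregular points are removed. *)
Lemma surface_locally_punctured_connected (X : cspace R) (x : X) :
  charted X -> locally_punctured_connected x.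
Proof.
move=> [cX aX] U xU; have [c ac cx] := aX x.
have hc := cX c ac.
have h : nbhs (cmap c x) [set z | U (cinv c z) /\ cdom c (cinv c z) /\ cmap c (cinv c z) = z].
  apply: filterI; last exact: chart_near_inv.
  by apply: (chart_cinv_at hc cx); rewrite (chart_cinvK hc cx).
have [V [xV VU cV]] := @cplx_locally_punctured_connected R (cmap c x) _ h.
exists (cinv c @` V); split.
- have : nbhs x (cdom c `&` (cmap c @^-1` V)).
    apply: filterI; first exact: chart_nbhs.
    exact: (chart_cmap_at hc cx).
  by apply: filterS => y [cy Vy]; exists (cmap c y) => //; rewrite chart_cinvK.
- by move=> _ [z Vz <-]; exact: (VU z Vz).1.
have -> : (cinv c @` V) `\ x = cinv c @` (V `\ cmap c x).
  apply/seteqP; split => y.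
    case=> -[z Vz <-] zx; exists z => //; split => // E.
    by apply: zx; rewrite /= E chart_cinvK.
  case=> z [Vz zx] <-; split; first by exists z.
  by move=> E; apply: zx; rewrite /= -E (VU z Vz).2.2.
apply: connected_continuous_connected => //.
apply: continuous_in_subspaceT => z; rewrite inE => -[Vz _].
have [_ [dz E]] := VU z Vz.
by rewrite -E; apply: chart_cinv_at.
Qed.

End Charts.

(** * The orbit space *)

Lemma plane_cdiff_near_eq (R : realType) (X : cspace R) (f g : X -> cplx R) x :
  charted X -> {near x, f =1 g} ->
  @cdiff_at R X (plane R) f x -> @cdiff_at R X (plane R) g x.
Proof.
move=> [cX _] fg [fc fd]; split; first exact: continuous_near_eq fg fc.
move=> c d ac ad cx _.
have := fd c d ac ad cx; rewrite ad /= => /(_ I).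
apply: near_eq_derivable.
have : nbhs (cmap c x) (cinv c @^-1` [set y | f y = g y]).
  by apply: (chart_cinv_at (cX _ ac) cx); rewrite (chart_cinvK (cX _ ac) cx).
by apply: filterS => z /= ->.
Qed.

Section Orbits.
Variables (R : realType) (X : cspace R) (tau : X -> X) (p : nat).
Local Notation C := (cplx R).
Hypothesis rX : riemann_surface X.
Hypothesis ht : holomorphic tau.
Hypothesis hp : has_order tau p.
Local Notation tauj j := (iter j tau).
Local Notation pi := (@orbit_pi R X tau).

Let p0 : (0 < p)%N. Proof. by case: hp. Qed.
Let taup x : tauj p x = x. Proof. by case: hp => _ + _; apply. Qed.

Lemma iter_mul_order q x : tauj (q * p) x = x.
Proof. by elim: q => // q IH; rewrite mulSn iterD IH taup. Qed.

Lemma iter_modn_order j x : tauj (j %% p) x = tauj j x.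
Proof. by rewrite {2}(divn_eq j p) addnC iterD iter_mul_order. Qed.

Lemma iter_continuous j x : {for x, continuous (tauj j)}.
Proof. by have [] := @cdiff_iter _ _ tau j x rX ht. Qed.

Lemma orbit_pi_iorbit x y : pi x = pi y <-> iorbit tau x = iorbit tau y.
Proof. by split=> [/eqmodP/asboolP//|h]; exact/eqmodP/asboolP. Qed.

Lemma orbit_pi_eq x y : pi x = pi y <-> exists j, y = tauj j x.
Proof.
rewrite orbit_pi_iorbit; split=> [E|[j ->]].
  have : iorbit tau y y by exists 0%N.
  by rewrite -E => -[j _ <-]; exists j.
apply/seteqP; split => _ [k _ <-]; last by exists (k + j)%N => //; rewrite iterD.
(* A nonnegative exponent congruent to k - j modulo p, standing for the inverse of the j-th iterate
   followed by the k-th. *)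
exists (k + (p - j %% p))%N => //.
rewrite -iterD (_ : (_ + j)%N = (k + (j %/ p).+1 * p)%N).
  by rewrite iterD iter_mul_order.
move: (ltn_pmod j p0) (divn_eq j p); rewrite mulSn.
by move: (j %% p)%N (j %/ p * p)%N => s q; lia.
Qed.

Lemma orbit_pi_iter j x : pi (tauj j x) = pi x.
Proof. by apply/esym/orbit_pi_eq; exists j. Qed.

Lemma orbit_pi_continuous : continuous pi.
Proof. exact: pi_continuous. Qed.

(** The saturation of [V] is the union of its preimages under the iterates, so continuity of the
    iterates is enough. *)
Lemma orbit_pi_open (V : set X) : open V -> open (pi @` V).
Proof.
move=> oV.
have E : pi @^-1` (pi @` V) = \bigcup_j (tauj j @^-1` V).
  apply/seteqP; split => [x [y Vy /esym/orbit_pi_eq[j yE]]|x [j _ Vj]].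
    by exists j => //=; rewrite -yE.
  by exists (tauj j x) => //; rewrite orbit_pi_iter.
suff : open (pi @^-1` (pi @` V)) by [].
rewrite E; apply: bigcup_open => j _; apply: open_comp => // x _.
exact: iter_continuous.
Qed.

Lemma orbit_pi_open_at x : open_at pi x.
Proof.
move=> U; rewrite {1}nbhsE => -[V [oV Vx] VU].
have : nbhs (pi x) (pi @` V).
  apply: open_nbhs_nbhs; split; [exact: orbit_pi_open|by exists x].
by apply: filterS; exact: image_subset.
Qed.

Lemma orbit_continuous_at (T : topologicalType) (f : orbit_T tau -> T) x :
  {for x, continuous (f \o pi)} -> {for pi x, continuous f}.
Proof.
move=> fc W /fc /orbit_pi_open_at; apply: filterS => _ [y Wy <-]; exact: Wy.
Qed.

Section QuotientChart.
Variables (c : chart R X) (P : X) (n e : nat) (w : C) (V : set X).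
Hypotheses (hc : holo_chart c) (e0 : (0 < e)%N) (hw : e.-primitive_root w).
Hypotheses (oV : open V) (Vc : V `<=` cdom c).
Let t (Q : X) : C := cmap c Q - cmap c P.
Hypothesis Vt : forall Q, V Q -> V (tauj n Q) /\ t (tauj n Q) = w * t Q.
Hypothesis Vn : forall Q j, V Q -> V (tauj j Q) -> (n %| j)%N.

Lemma iter_rotation q Q : V Q -> V (tauj (q * n) Q) /\ t (tauj (q * n) Q) = w ^+ q * t Q.
Proof.
move=> VQ; elim: q => [|q [IH1 IH2]]; first by rewrite mul0n expr0 mul1r.
rewrite mulSn iterD; have [h1 ->] := Vt IH1.
by split => //; rewrite IH2 mulrA exprS.
Qed.

(** The power t^e is constant on orbits because w^e = 1. It separates them because [w] is primitive:
    points with equal e-th powers differ by a power of [w], which an iterate of tau^n realises.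
    Unbranched points are the case e = 1, n = p, w = 1. *)
Lemma quotient_chart : exists d : chart R (orbit_space tau),
  [/\ atlas (orbit_space tau) d, cdom d = pi @` V
    & forall Q, V Q -> cmap d (pi Q) = t Q ^+ e].
Proof.
have we : w ^+ e = 1 by exact: prim_expr_order.
have tE Q Q' : V Q -> V Q' -> pi Q = pi Q' -> t Q ^+ e = t Q' ^+ e.
  move=> VQ VQ' /orbit_pi_eq[j Qj]; rewrite Qj in VQ' *.
  have /dvdnP[q qE] := Vn VQ VQ'; rewrite qE (iter_rotation q VQ).2.
  by rewrite exprMn -exprM mulnC exprM we expr1n mul1r.
pose phi (u : orbit_T tau) : C := if pselect (exists2 Q, V Q & pi Q = u) is left h
  then t (projT1 (cid2 h)) ^+ e else 0.
have phiE Q : V Q -> phi (pi Q) = t Q ^+ e.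
  move=> VQ; rewrite /phi; case: pselect => [h|]; last by case; exists Q.
  by case: cid2 => Q' /= VQ' E; exact: tE.
have hcc : is_chart c by case: hc.
have cX := riemann_surface_charted rX.
have tcont Q : V Q -> {for Q, continuous t}.
  move=> VQ; apply: (@cvgB C); last exact: cvg_cst.
  exact: chart_cmap_at hcc (Vc VQ).
have phinear Q : V Q -> {near Q, (fun Q => t Q ^+ e) =1 phi \o pi}.
  move=> VQ; have : nbhs Q V by exact: open_nbhs_nbhs.
  by apply: filterS => Q' VQ' /=; rewrite phiE.
have [psi hpsi] : exists psi, is_chart (Chart (pi @` V) phi psi).
  apply: (chart_of_open_inj (pi P)); first exact: orbit_pi_open.
    move=> u v; rewrite !inE => -[Q VQ <-] [Q' VQ' <-].
    rewrite !phiE// => E.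
    have [q qe] : exists q, t Q' = w ^+ q * t Q.
      have [tQ0|tQ0] := eqVneq (t Q) 0.
        exists 0%N; rewrite tQ0 mulr0; apply/eqP.
        by move: E => /esym/eqP; rewrite tQ0 expr0n (gtn_eqF e0) expf_eq0 e0.
      have : (t Q' / t Q) ^+ e = 1 by rewrite expr_div_n -E divff// expf_neq0.
      by move/(prim_rootP hw) => [q qE]; exists q; rewrite -qE divfK.
    rewrite -(iter_rotation q VQ).2 in qe.
    apply/orbit_pi_eq; exists (q * n)%N.
    apply: (chart_inj hcc); rewrite ?inE; [exact: Vc| |].
      by apply: Vc; exact: (iter_rotation q VQ).1.
    exact: addIr qe.
  move=> _ [Q VQ <-]; split.
    apply: orbit_continuous_at; apply: (continuous_near_eq (phinear Q VQ)).
    by apply: (@cvg_pow C); exact: tcont.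
  move=> W piW.
  have h1 : nbhs Q ((pi @^-1` W) `&` V).
    by apply: filterI; [exact: orbit_pi_continuous|exact: open_nbhs_nbhs].
  have h2 := @open_at_pow C e (t Q) e0.
  have h3 : nbhs (cmap c Q) (cmap c @` ((pi @^-1` W) `&` V)).
    by apply: (chart_open_at hcc (Vc VQ)).
  have h4 : nbhs (t Q) (t @` ((pi @^-1` W) `&` V)).
    have h : {for t Q, continuous (fun z : C => z + cmap c P)}.
      by apply: (@cvgD _ _ _ (nbhs (t Q))); [exact: cvg_id|exact: cvg_cst].
    have : nbhs (t Q) ((fun z : C => z + cmap c P) @^-1` (cmap c @` ((pi @^-1` W) `&` V))).
      by apply: h; rewrite /t subrK.
    by apply: filterS => z [Q' HQ' E]; exists Q' => //; rewrite /t E addrK.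
  have := h2 _ h4; rewrite phiE//.
  apply: filterS => _ [_ [Q' [WQ' VQ'] <-] <-].
  by exists (pi Q') => //; rewrite phiE.
exists (@Chart R (orbit_T tau) (pi @` V) phi psi); split => //=.
split => // x /= [Q VQ /esym/orbit_pi_eq[j QE]].
(* Only the orbit of [x] has to meet [V], so the composite with the projection is computed after an
   iterate of [tau] has moved the point into [V]. *)
pose f (Q : X) : C := t (tauj j Q) ^+ e.
have ff : {near x, f =1 phi \o pi}.
  have VQ' : V (tauj j x) by rewrite -QE.
  have : nbhs x (tauj j @^-1` V).
    by apply: iter_continuous; exact: open_nbhs_nbhs.
  by apply: filterS => y Vy /=; rewrite /f -(orbit_pi_iter j y) phiE.
apply: (plane_cdiff_near_eq cX ff).
have -> : f = ((fun z : C => (z - cmap c P) ^+ e) \o (cmap c \o tauj j)) by [].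
apply: plane_cdiff_comp => //.
  apply: (@cdiff_comp R X X (plane R) (tauj j) (cmap c) x) => //.
    exact: cdiff_iter.
  by apply: holo_chart_cdiff => //; apply: Vc; rewrite -QE.
apply: (@derivable_comp1 C (fun z => z - cmap c P) (fun z => z ^+ e)).
  by apply: derivableB; [exact: derivable_id|exact: derivable_cst].
exact: exprn_derivable.
Qed.

End QuotientChart.
End Orbits.

(** * Invariant discs, and freeness of the action off the branched points *)

Section RotationDiscs.
Variables (R : realType) (X : cspace R) (tau : X -> X) (p : nat).
Local Notation C := (cplx R).
Hypothesis rX : riemann_surface X.
Hypothesis ht : holomorphic tau.
Hypothesis hp : has_order tau p.
Local Notation tauj j := (iter j tau).
Local Notation pi := (@orbit_pi R X tau).

Let p0 : (0 < p)%N. Proof. by case: hp. Qed.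
Let taup x : tauj p x = x. Proof. by case: hp => _ + _; apply. Qed.
Let cX : charted X. Proof. exact: riemann_surface_charted. Qed.
Let hausX : hausdorff_space X. Proof. by case: rX. Qed.

(** These are the conditions under which a power of the coordinate descends to the quotient. The
    coordinate is recentred at [P] so that arbitrary charts of the atlas may be used at unbranched
    points. *)
Definition rotation_disc (c : chart R X) (P : X) (n : nat) (w : C) (V : set X) :=
  [/\ open V, V P, V `<=` cdom c,
      forall Q, V Q -> V (tauj n Q) /\
        cmap c (tauj n Q) - cmap c P = w * (cmap c Q - cmap c P)
    & forall Q j, V Q -> V (tauj j Q) -> (n %| j)%N].

Lemma separating_nbhs (P : X) (n : nat) :
  (forall j, (0 < j < n)%N -> tauj j P <> P) ->
  exists2 A, nbhs P A & forall Q j, (0 < j < n)%N -> A Q -> ~ A (tauj j Q).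
Proof.
elim: n => [|n IH] Pn; first by exists setT; [exact: filterT|move=> Q j; rewrite ltn0 andbF].
have [|A PA HA] := IH.
  by move=> j /andP[j0 jn]; apply: Pn; rewrite j0 ltnW.
have [n0|n0] := posnP n.
  exists A => // Q j; rewrite n0; by case: j.
have Pn' : tauj n P != P by apply/eqP/Pn; rewrite n0 ltnSn.
have := hausX; rewrite open_hausdorff => /(_ _ _ Pn').
case=> -[B D] /=; rewrite !inE => -[BP DP] [oB oD BD0].
(* A point of [D] sent by the n-th iterate into [B], which is disjoint from [D], cannot return;
   smaller iterates are handled by [A]. *)
exists (A `&` (D `&` (tauj n @^-1` B))).
  apply: filterI => //; apply: filterI; first exact: open_nbhs_nbhs.
  by apply: (@iter_continuous _ _ tau); [| |exact: open_nbhs_nbhs].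
move=> Q j /andP[j0]; rewrite ltnS leq_eqVlt => /orP[/eqP ->|jn].
  move=> [_ [_ BQ]] [_ [DQ _]].
  by have : (B `&` D) (tauj n Q) by []; rewrite BD0.
move=> [AQ _] [AjQ _]; apply: (HA Q j) => //; by rewrite j0.
Qed.

(** In the coordinate tau^n is a rotation, so the pullback of a small round disc about the image of
    [P] is invariant. *)
Lemma exists_rotation_disc (c : chart R X) (P : X) (n : nat) (w : C) (N : set X) :
  is_chart c -> cdom c P -> (0 < n)%N -> `|w| = 1 ->
  (forall j, (0 < j < n)%N -> tauj j P <> P) ->
  (\forall Q \near P, cdom c Q -> cdom c (tauj n Q) /\
     cmap c (tauj n Q) - cmap c P = w * (cmap c Q - cmap c P)) ->
  nbhs P N -> exists2 V, V `<=` N & rotation_disc c P n w V.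
Proof.
move=> hc cP n0 w1 Pn rot PN.
have [A PA HA] := separating_nbhs Pn.
have h : nbhs (cmap c P) (cinv c @^-1` (N `&` A `&`
   [set Q | cdom c Q -> cdom c (tauj n Q) /\
     cmap c (tauj n Q) - cmap c P = w * (cmap c Q - cmap c P)])).
  apply: (chart_cinv_at hc cP); rewrite chart_cinvK//.
  by apply: filterI => //; apply: filterI.
have [B [oB BP BU Brot]] := nbhs_rotation_invariant h.
pose V : set X := [set Q | cdom c Q /\ B (cmap c Q)].
have VP : V P by split.
have VH Q : V Q -> [/\ N Q, A Q & cdom c Q -> cdom c (tauj n Q) /\
     cmap c (tauj n Q) - cmap c P = w * (cmap c Q - cmap c P)].
  by move=> [cQ /BU]; rewrite /= chart_cinvK// => -[[]].
have Vn Q : V Q -> V (tauj n Q) /\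
        cmap c (tauj n Q) - cmap c P = w * (cmap c Q - cmap c P).
  move=> VQ; have [_ _ /(_ VQ.1)[cnQ E]] := VH _ VQ; split => //; split => //.
  exact: Brot w1 E VQ.2.
have Vqn Q q : V Q -> V (tauj (q * n) Q).
  move=> VQ; elim: q => // q IH; rewrite mulSn iterD.
  by have [] := Vn _ IH.
exists V; first by move=> Q /VH[].
split => //.
- rewrite openE => Q [cQ bQ].
  have h1 : nbhs Q (cmap c @^-1` B).
    by apply: (chart_cmap_at hc cQ); exact: open_nbhs_nbhs.
  by move: (chart_nbhs hc cQ) h1; rewrite /interior; apply: filterS2 => y.
- by move=> Q [].
(* By invariance of [V] the exponent may be reduced modulo [n], and the separating neighbourhood
   excludes every nonzero remainder. *)
move=> Q j VQ VjQ; apply: contrapT => nj.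
have := Vqn Q (j %/ n)%N VQ; set Q' := tauj _ Q => VQ'.
have E : tauj j Q = tauj (j %% n) Q' by rewrite /Q' -iterD addnC -divn_eq.
have [_ AQ' _] := VH _ VQ'; have [_ AjQ _] := VH _ VjQ.
apply: (HA Q' (j %% n)%N) => //; last by rewrite -E.
by rewrite ltn_pmod// andbT lt0n; apply/negP.
Qed.

Variable zeta : C.
Hypothesis hz : p.-primitive_root zeta.
Hypothesis hbr : forall x, branched_point (@orbit_proj R X tau) x ->
  exists n k, [/\ (n %| p)%N, coprime (p %/ n) k &
    rotation_number p zeta tau x n k].

Lemma unbranched_inj x : ~ branched_point (@orbit_proj R X tau) x ->
  exists2 U : set X, nbhs x U & set_inj U pi.
Proof. by move=> h; apply: contrapT. Qed.

(* The set where an iterate of tau is locally the identity is open, and it is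
   closed because tau acts by a rotation near branched points and freely
   elsewhere; this replaces the identity theorem. *)
Lemma iter_locally_id j (U : set X) : U !=set0 -> open U ->
  (forall Q, U Q -> tauj j Q = Q) -> (p %| j)%N.
Proof.
move=> [Q0 UQ0] oU Uj.
pose E := [set Q | tauj j Q = Q].
have clE : closed E.
  have -> : E = ~` [set Q | tauj j Q <> Q] 
    by apply/seteqP; split => Q /=; [move=> ? h; exact: h|exact: contrapT].
  apply: open_closedC; rewrite openE => Q /= /eqP neq.
  have := hausX; rewrite open_hausdorff => /(_ _ _ neq).
  case=> -[B D] /=; rewrite !inE => -[BP DP] [oB oD BD0].
  have h1 : nbhs Q (tauj j @^-1` B).
    by apply: (@iter_continuous _ _ tau); [| |exact: open_nbhs_nbhs].
  have h2 : nbhs Q D by exact: open_nbhs_nbhs.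
  move: h1 h2; apply: filterS2 => y By Dy Ey.
  have : (B `&` D) (tauj j y) by split => //; rewrite Ey.
  by rewrite BD0.
have oI : open E° by exact: open_interior.
have clI : closed E°.
  move=> Q clQ.
  have EQ : tauj j Q = Q.
    have := clE Q; rewrite /E /=; apply => W /clQ[y [/interior_subset Ey Wy]].
    by exists y.
  have [br|nbr] := pselect (branched_point (@orbit_proj R X tau) Q); last first.
    have [W QW injW] := unbranched_inj nbr.
    have h1 : nbhs Q (tauj j @^-1` W).
      by apply: (@iter_continuous _ _ tau) => //; rewrite EQ.
    move: h1 QW; apply: filterS2 => y Wjy Wy.
    by apply: injW; rewrite ?inE//; exact: (orbit_pi_iter hp).
  have [n [k [np co [n0 Qn Qmin _ [c [[hc _] cQ cQ0 cn rot]]]]]] := hbr br.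
  have nj : (n %| j)%N.
    apply: contrapT => /negP; rewrite /dvdn -lt0n => jn0.
    apply: (Qmin (j %% n)%N); first by rewrite jn0 ltn_pmod.
    rewrite -[RHS]EQ {2}(divn_eq j n) addnC iterD; congr (tauj _ _).
    by elim: (j %/ n)%N => // q IH; rewrite mulSn iterD -IH Qn.
  have cq q y : cdom c y -> cdom c (tauj (q * n) y) /\
      cmap c (tauj (q * n) y) = ((zeta ^+ n) ^+ k) ^+ q * cmap c y.
    move=> cy; elim: q => [|q [IH1 IH2]]; first by rewrite mul0n expr0 mul1r.
    rewrite mulSn iterD rot// IH2 mulrA -exprS; split => //.
    by rewrite -cn; exists (tauj (q * n) y).
  have /dvdnP[q jE] := nj.
  (* [Q] is only a limit of interior points. At one of them off the centre of the chart the
     coordinate can be cancelled, so the rotation factor is 1 and the iterate is the identity on the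
     whole chart. *)
  have [y [Ey cy y0]] : exists y, [/\ E° y, cdom c y & cmap c y != 0].
    have [y [Ey cy]] := clQ _ (chart_nbhs hc cQ).
    have [y0|] := eqVneq (cmap c y) 0; last by exists y.
    have : nbhs (cmap c y) (cmap c @` (E° `&` cdom c)).
      apply: (chart_open_at hc cy).
      by apply: filterI; [exact: open_nbhs_nbhs|exact: chart_nbhs].
    rewrite y0 => /nbhs_normP[d /= d0 Hd].
    have [z [z0 zd]] : exists z : C, z != 0 /\ `|0 - z| < d.
      exists (d / 2); rewrite mulf_neq0 ?gt_eqF ?invr_gt0//; split => //.
      by rewrite sub0r normrN gtr0_norm ?divr_gt0// ltr_pdivrMr// ltr_pMr// ltr1n.
    have [y' [Ey' cy'] yz] := Hd z zd.
    by exists y'; split => //; rewrite yz.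
  have w1 : ((zeta ^+ n) ^+ k) ^+ q = 1.
    have := (cq q y cy).2; rewrite -jE (interior_subset Ey) => /esym h.
    by apply: (mulIf y0); rewrite h mul1r.
  have := chart_nbhs hc cQ; apply: filterS => y' cy'.
  apply: (chart_inj hc); rewrite ?inE// jE.
    exact: (cq q y' cy').1.
  by rewrite (cq q y' cy').2 w1 mul1r.
have IT : E° = [set: X].
  case: (rX) => _ [conX _] _ _ _; apply: conX.
  - exists Q0; rewrite /interior; have : nbhs Q0 U by exact: open_nbhs_nbhs.
    by apply: filterS.
  - by exists E° => //; rewrite setTI.
  - by exists E° => //; rewrite setTI.
apply: contrapT => /negP; rewrite /dvdn -lt0n => j0.
case: hp => _ _ /(_ (j %% p)%N); rewrite j0 ltn_pmod// => /(_ isT); apply => Q.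
rewrite (iter_modn_order hp).
by apply: (@interior_subset _ E); rewrite IT.
Qed.

(** If an iterate fixed [x], nearby points and their images would lie in a set where the projection
    is injective, so the iterate would be the identity near [x]. *)
Lemma unbranched_free x : ~ branched_point (@orbit_proj R X tau) x ->
  forall j, (0 < j < p)%N -> tauj j x <> x.
Proof.
move=> /unbranched_inj[W]; rewrite nbhsE => -[U [oU Ux] UW] injW j /andP[j0 jp] E.
have : (p %| j)%N.
  apply: (@iter_locally_id j (U `&` (tauj j @^-1` U))).
  - by exists x; split => //; rewrite /preimage /= E.
  - apply: openI => //; apply: open_comp => // y _; exact: (iter_continuous rX ht).
  move=> Q [UQ UjQ]; apply: injW; rewrite ?inE; [exact: UW|exact: UW|].
  exact: (orbit_pi_iter hp).
by rewrite gtnNdvd.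
Qed.

Lemma unbranched_disc x (c : chart R X) (N : set X) :
  ~ branched_point (@orbit_proj R X tau) x -> is_chart c -> cdom c x ->
  nbhs x N -> exists2 V, V `<=` N & rotation_disc c x p 1 V.
Proof.
move=> ux hc cx; apply: exists_rotation_disc => //; first by rewrite normr1.
  exact: unbranched_free.
by apply: nearW => Q cQ; rewrite taup mul1r.
Qed.

Lemma branched_disc x n k (c : chart R X) (N : set X) :
  (n %| p)%N -> coprime (p %/ n) k -> (0 < n)%N ->
  (forall j, (0 < j < n)%N -> tauj j x <> x) ->
  is_chart c -> cdom c x -> cmap c x = 0 -> tauj n @` cdom c = cdom c ->
  (forall x, cdom c x -> cmap c (tauj n x) = (zeta ^+ n) ^+ k * cmap c x) ->
  nbhs x N -> exists2 V, V `<=` N & rotation_disc c x n ((zeta ^+ n) ^+ k) V.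
Proof.
move=> np co n0 xmin hc cx cx0 cn rot; apply: exists_rotation_disc => //.
  exact: (prim_root_norm (rotation_root hz np co)).
apply: nearW => Q cQ; rewrite cx0 !subr0 rot//; split => //.
by rewrite -cn; exists Q.
Qed.

(** Rotation discs supply a chart around every orbit, branched or not; this is needed to compose the
    projection with [Psi]. *)
Lemma charted_orbit_space : charted (orbit_space tau).
Proof.
split=> [c []//|u].
rewrite -[u]reprK; move: (repr u) => x.
suff [c [n [e [w [V [hc e0 hw [oV Vx Vc Vt Vn]]]]]]] : exists c n e w V,
  [/\ holo_chart c, (0 < e)%N, e.-primitive_root w & rotation_disc c x n w V].
  have [d [ad dd _]] := quotient_chart rX ht hp hc e0 hw oV Vc Vt Vn.
  by exists d => //; rewrite dd; exists x.
have [br|nbr] := pselect (branched_point (@orbit_proj R X tau) x).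
  have [n [k [np co [n0 Qn Qmin _ [c [hc cQ cQ0 cn rot]]]]]] := hbr br.
  have [V _ HV] := branched_disc np co n0 Qmin hc.1 cQ cQ0 cn rot filterT.
  exists c, n, (p %/ n)%N, ((zeta ^+ n) ^+ k), V; split => //.
    by rewrite divn_gt0// dvdn_leq.
  exact: (rotation_root hz).
have [c ac cx] := cX.2 x.
have hc := atlas_holo_chart rX ac.
have [V _ HV] := unbranched_disc nbr hc.1 cx filterT.
by exists c, p, 1%N, 1, V; split => //; exact: prim_root1.
Qed.

Lemma orbit_proj_holomorphic : holomorphic (@orbit_proj R X tau).
Proof.
move=> x; split; first exact: orbit_pi_continuous.
move=> c d ac [hd dx] cx dpx.
by have [_ /(_ c (Chart setT id id) ac erefl cx I)] := dx x dpx.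
Qed.

End RotationDiscs.

(** * Roots over plane domains *)

Lemma open_meets_cofinite (K : numClosedFieldType) (D S : set K) :
  open D -> D !=set0 -> finite_set S -> (D `\` S) !=set0.
Proof.
move=> oD D0 /finite_seqP[l ->] {S}.
elim: l D oD D0 => [|s l IH] D oD D0; first by rewrite set_nil setD0.
have [||z [[Dz zs] zl]] := IH (D `\ s).
- by apply: (openD_finite _ oD); [exact: norm_hausdorff|exact: finite_set1].
- case: D0 => z Dz; have [zs|] := eqVneq z s; last by move/eqP; exists z.
  have : nbhs z D by exact: open_nbhs_nbhs.
  move=> /nbhs_normP[d /= d0 Hd]; exists (z + d / 2); split.
    apply: Hd; rewrite /= opprD addrA subrr add0r normrN gtr0_norm ?divr_gt0//.
    by rewrite ltr_pdivrMr// ltr_pMr// ltr1n.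
  rewrite /= zs => /eqP; rewrite -subr_eq0 addrC addKr; apply/negP.
  by rewrite mulf_neq0 ?gt_eqF ?invr_gt0.
by exists z; split => //= ; rewrite in_cons => /orP[/eqP|].
Qed.

Section Torsor.
Variables (R : realType) (X : topologicalType) (tau : X -> X).
Local Notation C := (cplx R).
Local Notation tauj j := (iter j tau).
Variables (xi : X -> option C) (p : nat) (zeta : C) (f : C -> C) (S : set C).
Hypothesis p0 : (0 < p)%N.
Hypothesis fS : finite_set S.
Hypothesis f0 : forall z, ~ S z -> f z != 0.
Hypothesis f0' : forall z, S z -> f z = 0.
Hypothesis xi_surj : forall z, exists Q, xi Q = Some z.
Hypothesis xi_tau : forall Q, xi (tau Q) = xi Q.
Hypothesis xi_fiber : forall Q Q', xi Q = xi Q' -> exists j, Q' = tauj j Q.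
Hypothesis xi_cont : forall Q z (W : set C), xi Q = Some z -> nbhs z W ->
  \forall Q' \near Q, exists2 z', xi Q' = Some z' & W z'.
Hypothesis xi_open : forall Q z U, xi Q = Some z -> nbhs Q U ->
  \forall z' \near z, exists2 Q', U Q' & xi Q' = Some z'.

(** A total function constrained only over [D], so that restriction and gluing need no subtypes.
    Equivariance makes two solutions comparable on a whole fibre once they are compared at one point
    of it. *)
Definition root_over (D : set C) (y : X -> C) := forall Q z, xi Q = Some z -> D z ->
  [/\ {for Q, continuous y}, y (tau Q) = zeta * y Q & y Q ^+ p = f z].

Lemma root_over_sub D D' y : D `<=` D' -> root_over D' y -> root_over D y.
Proof. by move=> DD h Q z Qz /DD; exact: h. Qed.

Lemma xi_iter j Q : xi (tauj j Q) = xi Q.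
Proof. by elim: j => //= j IH; rewrite xi_tau. Qed.

Lemma root_over_iter D y Q z j : root_over D y -> xi Q = Some z -> D z ->
  y (tauj j Q) = zeta ^+ j * y Q.
Proof.
move=> h Qz Dz; elim: j => [|j IH]; first by rewrite mul1r.
rewrite iterS; have [||_ -> _] := h (tauj j Q) z; rewrite ?xi_iter//.
by rewrite IH exprS mulrA.
Qed.

Lemma root_over_eq_fiber D y1 y2 Q Q' z : root_over D y1 -> root_over D y2 ->
  xi Q = Some z -> xi Q' = Some z -> D z -> y1 Q = y2 Q -> y1 Q' = y2 Q'.
Proof.
move=> h1 h2 Qz Q'z Dz E; have [j ->] : exists j, Q' = tauj j Q.
  by apply: xi_fiber; rewrite Qz.
by rewrite (root_over_iter j h1 Qz Dz) E (root_over_iter j h2 Qz Dz).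
Qed.

(** Off [S] the two functions have equal nonzero p-th powers, so agreement is an open condition, and
    disagreement is open by continuity. [D] minus [S] is still connected, and over [S] both
    functions vanish. *)
Lemma root_over_unique D y1 y2 Q0 z0 : open D -> connected D ->
  root_over D y1 -> root_over D y2 ->
  xi Q0 = Some z0 -> D z0 -> ~ S z0 -> y1 Q0 = y2 Q0 ->
  forall Q z, xi Q = Some z -> D z -> y1 Q = y2 Q.
Proof.
move=> oD cD h1 h2 Qz0 Dz0 Sz0 E0.
have cD' : connected (D `\` S).
  apply: connected_setD_finite => //.
  by move=> s _; exact: cplx_locally_punctured_connected.
have oD' : open (D `\` S) by apply: openD_finite => //; exact: norm_hausdorff.
pose EQ := [set z | forall Q, xi Q = Some z -> y1 Q = y2 Q].
pose NE := [set z | forall Q, xi Q = Some z -> y1 Q <> y2 Q].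
have nearEQ z : (D `\` S) z -> EQ z -> EQ° z.
  move=> D'z EQz; have [Q Qz] := xi_surj z.
  have [c1 _ p1] := h1 Q z Qz D'z.1; have [c2 _ p2] := h2 Q z Qz D'z.1.
  have y1Q : y1 Q != 0.
    by have := f0 D'z.2; rewrite -p1 expf_eq0 p0.
  have n1 : \forall Q' \near Q, y1 Q' ^+ p = y2 Q' ^+ p -> y1 Q' = y2 Q'.
    apply: (@pow_inj_near C X (nbhs Q) _ y1 y2 (y1 Q) p p0 y1Q c1).
    rewrite (EQz Q Qz); exact: c2.
  have zD : nbhs z D by exact: open_nbhs_nbhs (conj oD D'z.1).
  move: (xi_open Qz n1) zD; rewrite /interior; apply: filterS2.
  move=> z' [Q' HQ' Q'z'] Dz' Q'' Q''z'.
  apply: (root_over_eq_fiber h1 h2 Q'z' Q''z' Dz'); apply: HQ'.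
  have [_ _ ->] := h1 Q' z' Q'z' Dz'.
  by have [_ _ ->] := h2 Q' z' Q'z' Dz'.
have nearNE z : (D `\` S) z -> ~ EQ z -> NE° z.
  move=> D'z EQz.
  have [Q Qz NQ] : exists2 Q, xi Q = Some z & y1 Q <> y2 Q.
    by apply: contrapT => H; apply: EQz => Q Qz; apply: contrapT => N; apply: H; exists Q.
  have [c1 _ p1] := h1 Q z Qz D'z.1; have [c2 _ p2] := h2 Q z Qz D'z.1.
  have n1 : \forall Q' \near Q, y1 Q' - y2 Q' != 0.
    have ne : y1 Q - y2 Q != 0 by rewrite subr_eq0; exact/eqP.
    have c12 : (fun Q' => y1 Q' - y2 Q') @ Q --> y1 Q - y2 Q.
      exact: (@cvgB C C X (nbhs Q) _ y1 y2 _ _ c1 c2).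
    exact: (@cvgr_neq0 C C X (nbhs Q) _ _ _ c12 ne).
  have zD : nbhs z D by exact: open_nbhs_nbhs (conj oD D'z.1).
  move: (xi_open Qz n1) zD; rewrite /interior; apply: filterS2.
  move=> z' [Q' HQ' Q'z'] Dz' Q'' Q''z' E.
  have := root_over_eq_fiber h1 h2 Q''z' Q'z' Dz' E.
  by move/eqP; rewrite -subr_eq0; apply/negP.
have ET : (D `\` S) `&` EQ = D `\` S.
  apply: cD'.
  - by exists z0; split => // Q Qz; apply: (root_over_eq_fiber h1 h2 Qz0 Qz).
  - exists EQ°; first exact: open_interior.
    apply/seteqP; split => z [D'z Ez]; split => //; first exact: nearEQ.
    exact: interior_subset Ez.
  exists (~` NE°); first by apply: open_closedC; exact: open_interior.
  apply/seteqP; split => z [D'z Ez]; split => //.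
    move=> /interior_subset NEz; have [Q Qz] := xi_surj z.
    exact: NEz Q Qz (Ez Q Qz).
  by apply: contrapT => /(nearNE _ D'z).
move=> Q z Qz Dz.
have [Sz|Sz] := pselect (S z); last first.
  have : (D `\` S) z by split.
  by rewrite -ET => -[_]; apply.
have zero (y : X -> C) : root_over D y -> y Q = 0.
  move=> h; have [_ _ /eqP] := h Q z Qz Dz.
  by rewrite f0'// expf_eq0 p0 => /eqP.
by rewrite !zero.
Qed.

Lemma root_over_scale D y w : root_over D y -> w ^+ p = 1 ->
  root_over D (fun Q => w * y Q).
Proof.
move=> h w1 Q z Qz Dz; have [yc yt yp] := h Q z Qz Dz; split.
- exact: (@cvgM C X (nbhs Q) _ (fun=> w) y _ _ (cvg_cst w) yc).
- by rewrite yt mulrCA.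
by rewrite exprMn w1 mul1r.
Qed.

Lemma root_over_normalize D y Q z w : root_over D y -> xi Q = Some z -> D z ->
  ~ S z -> w ^+ p = f z -> exists2 y', root_over D y' & y' Q = w.
Proof.
move=> h Qz Dz Sz wz; have [_ _ yp] := h Q z Qz Dz.
have y0 : y Q != 0 by have := f0 Sz; rewrite -yp expf_eq0 p0.
exists (fun Q' => w / y Q * y Q'); last by rewrite divfK.
by apply: root_over_scale => //; rewrite expr_div_n wz yp divff// f0.
Qed.

Lemma root_over_glue D1 D2 : open D1 -> open D2 -> connected (D1 `&` D2) ->
  (D1 `&` D2) !=set0 -> (exists y, root_over D1 y) -> (exists y, root_over D2 y) ->
  exists y, root_over (D1 `|` D2) y.
Proof.
move=> o1 o2 c12 n12 [y1 h1] [y2 h2].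
have o12 : open (D1 `&` D2) by exact: openI.
(* The base point must avoid [S]: there [y2] is nonzero and can be rescaled by a p-th root of unity
   to match [y1]. *)
have [z0 [[D1z D2z] Sz0]] := open_meets_cofinite o12 n12 fS.
have [Q0 Qz0] := xi_surj z0.
have [_ _ yp1] := h1 Q0 z0 Qz0 D1z.
have [y2' h2' E0] := root_over_normalize h2 Qz0 D2z Sz0 yp1.
have E Q z : xi Q = Some z -> D1 z -> D2 z -> y1 Q = y2' Q.
  move=> Qz D1z' D2z'.
  apply: (@root_over_unique (D1 `&` D2) y1 y2' Q0 z0) Qz _ => //.
  - by apply: root_over_sub h1 => ? [].
  - by apply: root_over_sub h2' => ? [].
pose y Q := if xi Q is Some z then if z \in D1 then y1 Q else y2' Q else 0.
have yE1 Q z : xi Q = Some z -> D1 z -> y Q = y1 Q.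
  by move=> Qz D1z'; rewrite /y Qz mem_set.
have yE2 Q z : xi Q = Some z -> D2 z -> y Q = y2' Q.
  move=> Qz D2z'; rewrite /y Qz; case: ifPn => //.
  by rewrite inE => D1z'; exact: E Qz D1z' D2z'.
have key (D : set C) (y' : X -> C) : open D -> root_over D y' ->
    (forall Q z, xi Q = Some z -> D z -> y Q = y' Q) -> root_over D y.
  move=> oD h yE Q z Qz Dz; have [yc yt yp] := h Q z Qz Dz.
  have e1 : y (tau Q) = y' (tau Q) by apply: (yE _ z); rewrite ?xi_tau.
  have e2 : y Q = y' Q by apply: (yE _ z).
  rewrite e1 e2; split; [apply: continuous_near_eq yc|exact: yt|exact: yp].
  have zD : nbhs z D by exact: open_nbhs_nbhs.
  have := xi_cont Qz zD; apply: filterS => Q' [z' Q'z' Dz'].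
  by rewrite (yE Q' z').
exists y => Q z Qz [Dz|Dz].
  exact: (key _ _ o1 h1 yE1).
exact: (key _ _ o2 h2' yE2).
Qed.

Lemma rect_sub (a b c d a' b' c' d' : R) : a' <= a -> b <= b' -> c' <= c -> d <= d' ->
  @rect R a b c d `<=` @rect R a' b' c' d'.
Proof. by move=> h1 h2 h3 h4 z [/andP[u1 u2] /andP[u3 u4]]; split; lra. Qed.

Hypothesis local_roots : forall z, exists D, [/\ open D, D z & exists y, root_over D y].

(** Continuation along a vertical segment, on a thin rectangle around it. *)
Lemma root_over_segment (x s t : R) : s <= t ->
  exists e, 0 < e /\ exists y, root_over (rect (x - e) (x + e) (s - e) (t + e)) y.
Proof.
move=> st.
pose Pr s t := exists e, 0 < e /\ exists y, root_over (rect (x - e) (x + e) (s - e) (t + e)) y.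
apply: (@interval_additive_ind R Pr s t st) => [v _|{st}s {}t u st tu].
  have [D [oD Dz [y hy]]] := local_roots ((x +i* v)%C : C).
  have [e e0 eD] := nbhs_rect (open_nbhs_nbhs (conj oD Dz)).
  exists (e / 2); first by rewrite divr_gt0.
  move=> s' t' h1 h2 h3 h4; exists (e / 2); split; first by rewrite divr_gt0.
  exists y; apply: root_over_sub hy; apply: subset_trans eD.
  by rewrite /re /im /=; apply: rect_sub; lra.
move=> [e1 [e10 [y1 h1]]] [e2 [e20 [y2 h2]]].
pose e := Num.min e1 e2.
have e0 : 0 < e by rewrite lt_min e10.
have ee1 : e <= e1 by rewrite ge_min lexx.
have ee2 : e <= e2 by rewrite ge_min lexx orbT.
exists e; split => //.
pose D1 : set C := rect (x - e) (x + e) (s - e) (t + e).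
pose D2 : set C := rect (x - e) (x + e) (t - e) (u + e).
have D12 : D1 `&` D2 = rect (x - e) (x + e) (t - e) (t + e).
  apply/seteqP; split => z; first by move=> [[? /andP[? ?]] [_ /andP[? ?]]]; split => //; lra.
  by move=> [? /andP[? ?]]; split; split => //; lra.
have [||||||y hy] := @root_over_glue D1 D2; try exact: open_rect.
- by rewrite D12; exact: connected_rect.
- by rewrite D12; exists (x +i* t)%C; rewrite /rect /re /im /=; split; lra.
- by exists y1; apply: root_over_sub h1; apply: rect_sub; lra.
- by exists y2; apply: root_over_sub h2; apply: rect_sub; lra.
exists y; apply: root_over_sub hy => z [? /andP[? ?]].
have [zt|zt] := ltP (im z) (t + e); [left|right]; split => //; lra.
Qed.

(** The same induction in the horizontal direction; thin columns of full height from the vertical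
    step play the role of the local solutions. *)
Lemma root_over_rect (s t c d : R) : s <= t -> c <= d ->
  exists e, 0 < e /\ exists y, root_over (rect (s - e) (t + e) c d) y.
Proof.
move=> st cd.
pose Pr s t := exists e, 0 < e /\ exists y, root_over (rect (s - e) (t + e) c d) y.
apply: (@interval_additive_ind R Pr s t st) => [v _|{st}s {}t u st tu].
  have [e [e0 [y hy]]] := root_over_segment v cd.
  exists (e / 2); first by rewrite divr_gt0.
  move=> s' t' h1 h2 h3 h4; exists (e / 2); split; first by rewrite divr_gt0.
  by exists y; apply: root_over_sub hy; apply: rect_sub; lra.
move=> [e1 [e10 [y1 h1]]] [e2 [e20 [y2 h2]]].
pose e := Num.min e1 e2.
have e0 : 0 < e by rewrite lt_min e10.
have ee1 : e <= e1 by rewrite ge_min lexx.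
have ee2 : e <= e2 by rewrite ge_min lexx orbT.
exists e; split => //.
pose D1 : set C := rect (s - e) (t + e) c d.
pose D2 : set C := rect (t - e) (u + e) c d.
have D12 : D1 `&` D2 = rect (t - e) (t + e) c d.
  apply/seteqP; split => z; first by move=> [[/andP[? ?] ?] [/andP[? ?] _]]; split => //; lra.
  by move=> [/andP[? ?] ?]; split; split => //; lra.
(* With zero height the rectangles are empty: any function qualifies, and there would be no overlap
   to glue along. *)
have [cd'|cd'] := eqVneq c d.
  exists y1 => Q z _ [_ /andP[? ?]]; exfalso; lra.
have cdlt : c < d by rewrite lt_neqAle cd'.
have [||||||y hy] := @root_over_glue D1 D2; try exact: open_rect.
- by rewrite D12; exact: connected_rect.
- by rewrite D12; exists (t +i* ((c + d) / 2))%C; rewrite /rect /re /im /=; split; lra.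
- by exists y1; apply: root_over_sub h1; apply: rect_sub; lra.
- by exists y2; apply: root_over_sub h2; apply: rect_sub; lra.
exists y; apply: root_over_sub hy => z [/andP[? ?] ?].
have [zt|zt] := ltP (re z) (t + e); [left|right]; split => //; lra.
Qed.

(** Solutions on growing squares, all given the same value at one fixed point off [S], agree by
    uniqueness wherever two of them are defined. *)
Lemma root_over_plane : exists y, root_over setT y.
Proof.
pose D (N : nat) : set C := rect (- N.+1%:R) N.+1%:R (- N.+1%:R) N.+1%:R.
have oD N : open (D N) by exact: open_rect.
have cD N : connected (D N) by exact: connected_rect.
have D0 N : D N 0 by rewrite /D /rect /re /im /=; split; rewrite oppr_lt0 ltr0Sn.
have DS N M : (N <= M)%N -> D N `<=` D M.
  by move=> NM; apply: rect_sub; rewrite ?lerN2 ler_nat.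
have Dz z : exists N, D N z.
  exists (Num.truncn (`|re z| + `|im z|)).
  have := truncnS_gt (`|re z| + `|im z|); rewrite /D /rect /=.
  move: (_.+1%:R) => M hM.
  have := ler_norm (re z); have := ler_norm (- re z); rewrite normrN.
  have := ler_norm (im z); have := ler_norm (- im z); rewrite normrN.
  by move: (normr_ge0 (re z)) (normr_ge0 (im z)) => *; split; lra.
have [z0 [D0z Sz0]] : (D 0%N `\` S) !=set0 by apply: open_meets_cofinite => //; exists 0.
have [Q0 Qz0] := xi_surj z0.
have [w wp _] := exists_near_root 0 (f z0) p0.
have HN N : exists y, root_over (D N) y /\ y Q0 = w.
  have [e [e0 [y hy]]] : exists e, 0 < e /\ exists y,
      root_over (rect (- N.+1%:R - e) (N.+1%:R + e) (- N.+1%:R) N.+1%:R) y.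
    by have := ler0n R N.+1; move=> N0; apply: root_over_rect; lra.
  have hy' : root_over (D N) y by apply: root_over_sub hy; apply: rect_sub; lra.
  have [y' h' E] := root_over_normalize hy' Qz0 (DS 0%N N (leq0n N) z0 D0z) Sz0 wp.
  by exists y'.
pose Y N := projT1 (cid (HN N)).
have hY N : root_over (D N) (Y N) by rewrite /Y; case: cid => ? [].
have YQ0 N : Y N Q0 = w by rewrite /Y; case: cid => ? [].
have Ywlog N M Q z : (N <= M)%N -> xi Q = Some z -> D N z -> Y N Q = Y M Q.
  move=> NM Qz DNz; apply: (@root_over_unique (D N) (Y N) (Y M) Q0 z0) Qz DNz => //.
  - by apply: root_over_sub (hY M); exact: DS.
  - exact: (DS 0%N N).
  - by rewrite !YQ0.
have YE N M Q z : xi Q = Some z -> D N z -> D M z -> Y N Q = Y M Q.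
  move=> Qz DN DM; case/orP: (leq_total N M) => NM; first exact: Ywlog Qz DN.
  by apply/esym; exact: Ywlog Qz DM.
pose y Q := if xi Q is Some z then Y (projT1 (cid (Dz z))) Q else 0.
have yE N Q z : xi Q = Some z -> D N z -> y Q = Y N Q.
  move=> Qz DN; rewrite /y Qz; case: cid => M /= DM; exact: YE Qz DM DN.
exists y => Q z Qz _; have [N DN] := Dz z.
have [yc yt yp] := hY N Q z Qz DN.
have e1 : y (tau Q) = Y N (tau Q) by apply: (yE _ _ z); rewrite ?xi_tau.
have e2 : y Q = Y N Q by apply: (yE _ _ z).
rewrite e1 e2; split; [apply: continuous_near_eq yc|exact: yt|exact: yp].
have zD : nbhs z (D N) by exact: open_nbhs_nbhs.
have := xi_cont Qz zD; apply: filterS => Q' [z' Q'z' Dz'].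
by rewrite (yE N Q' z').
Qed.

End Torsor.

(** * Local roots on the covering *)

Section CyclicCover.
Variables (R : realType) (X : cspace R) (tau : X -> X) (p : nat).
Local Notation C := (cplx R).
Local Notation tauj j := (iter j tau).
Local Notation pi := (@orbit_pi R X tau).
Hypothesis rX : riemann_surface X.
Hypothesis ht : holomorphic tau.
Hypothesis hp : has_order tau p.
Variable zeta : C.
Hypothesis hz : p.-primitive_root zeta.
Variables (Psi : orbit_space tau -> sphere R) (Phi : sphere R -> orbit_space tau).
Hypothesis hPsi : inverse_isos Psi Phi.

Let p0 : (0 < p)%N. Proof. by case: hp. Qed.
Let taup x : tauj p x = x. Proof. by case: hp => _ + _; apply. Qed.
Let cX : charted X. Proof. exact: riemann_surface_charted. Qed.

Definition quotient_coord (Q : X) : option C := Psi (orbit_proj tau Q).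
Local Notation xi := quotient_coord.

Lemma quotient_coord_surj (w : option C) : exists Q, xi Q = w.
Proof.
case: hPsi => _ _ _ PhiK; exists (repr (Phi w)).
by rewrite /quotient_coord /orbit_proj /orbit_pi reprK PhiK.
Qed.

Lemma quotient_coord_iter_tau j Q : xi (tauj j Q) = xi Q.
Proof. by rewrite /quotient_coord /orbit_proj (orbit_pi_iter hp). Qed.

Lemma quotient_coord_tau Q : xi (tau Q) = xi Q.
Proof. exact: (quotient_coord_iter_tau 1). Qed.

Lemma quotient_coord_fiber Q Q' : xi Q = xi Q' -> exists j, Q' = tauj j Q.
Proof.
case: hPsi => _ _ PsiK _ E; apply/(orbit_pi_eq hp).
by have := congr1 Phi E; rewrite !PsiK.
Qed.

Lemma quotient_coord_continuous Q : {for Q, continuous (xi : X -> sphere R)}.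
Proof.
apply: (@continuous_comp X (orbit_T tau) (sphere_T R) pi Psi).
  exact: orbit_pi_continuous.
by case: hPsi => h _ _ _; have [] := h (pi Q).
Qed.

Lemma quotient_coord_cont Q z (W : set C) : xi Q = Some z -> nbhs z W ->
  \forall Q' \near Q, exists2 z', xi Q' = Some z' & W z'.
Proof.
move=> Qz /one_point_compactification_some_nbhs zW.
have h : nbhs Q ((xi : X -> sphere R) @^-1` [set Some x | x in W]).
  by apply: quotient_coord_continuous; rewrite Qz.
by move: h; apply: filterS => Q' [z' Wz' E]; exists z'.
Qed.

Definition quotient_val (Q : X) : C := if xi Q is Some z then z else 0.

Lemma quotient_valE Q z : xi Q = Some z -> quotient_val Q = z.
Proof. by rewrite /quotient_val => ->. Qed.

Lemma quotient_val_continuous Q z : xi Q = Some z -> {for Q, continuous quotient_val}.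
Proof.
move=> Qz W; rewrite /= (quotient_valE Qz) => /(quotient_coord_cont Qz).
by apply: filterS => Q' [w E Ww]; rewrite /preimage /= (quotient_valE E).
Qed.

(** The projection is open, and [Psi] is open because its inverse [Phi] is continuous. *)
Lemma quotient_coord_open Q z U : xi Q = Some z -> nbhs Q U ->
  \forall z' \near z, exists2 Q', U Q' & xi Q' = Some z'.
Proof.
move=> Qz /(orbit_pi_open_at rX ht hp); case: hPsi => _ hPhi PsiK PhiK.
have [cPhi _] := hPhi (Some z).
have <- : Phi (Some z) = pi Q by rewrite -Qz /quotient_coord PsiK.
move=> /cPhi hU.
have : nbhs z (Some @^-1` (Phi @^-1` (pi @` U))) by exact: hU.
apply: filterS => z' [Q' UQ' E]; exists Q' => //.
by rewrite /quotient_coord /orbit_proj E PhiK.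
Qed.

Lemma zeta_neq0 : zeta != 0.
Proof.
apply/negP => /eqP z0; have := prim_expr_order hz.
by rewrite z0 expr0n (gtn_eqF p0) => /eqP; rewrite eq_sym oner_eq0.
Qed.

(* A root h on one rotation disc V spreads to the orbit of V by y(tau^-j Q) =
   zeta^-j h(Q); this is well defined since h (tau^n Q) = zeta^n h(Q). *)
Lemma root_over_orbit (f : C -> C) (n : nat) (V : set X) (h : X -> C) (D : set C) :
  open V ->
  (forall Q, V Q -> V (tauj n Q)) ->
  (forall Q j, V Q -> V (tauj j Q) -> (n %| j)%N) ->
  (forall Q, V Q -> {for Q, continuous h} /\ h (tauj n Q) = zeta ^+ n * h Q) ->
  (forall Q z, V Q -> xi Q = Some z -> h Q ^+ p = f z) ->
  (forall z, D z -> exists2 Q, V Q & xi Q = Some z) ->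
  exists y, root_over tau xi p zeta f D y.
Proof.
move=> oV Vn Vdiv hV hf DV.
pose y Q : C := if pselect (exists j, V (tauj j Q)) is left e
  then (zeta ^+ projT1 (cid e))^-1 * h (tauj (projT1 (cid e)) Q) else 0.
have znz j : zeta ^+ j != 0 by rewrite expf_neq0 ?zeta_neq0.
have hq q Q : V Q -> V (tauj (q * n) Q) /\ h (tauj (q * n) Q) = zeta ^+ (q * n) * h Q.
  move=> VQ; elim: q => [|q [IH1 IH2]]; first by rewrite mul0n expr0 mul1r.
  rewrite mulSn iterD; split; first exact: Vn.
  by rewrite (hV _ IH1).2 IH2 mulrA exprD.
have wd j j' Q : V (tauj j Q) -> V (tauj j' Q) ->
    (zeta ^+ j)^-1 * h (tauj j Q) = (zeta ^+ j')^-1 * h (tauj j' Q).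
  wlog jj' : j j' / (j <= j')%N.
    move=> H V1 V2; case/orP: (leq_total j j') => jj'; first exact: H.
    by apply/esym; exact: H.
  move=> V1 V2; have E : j' = (j' - j + j)%N by rewrite subnK.
  move: V2; rewrite E iterD => V2; have /dvdnP[q qE] := Vdiv _ _ V1 V2.
  rewrite qE (hq q _ V1).2 exprD mulrA invfM -mulrA [X in _ = X]mulrC.
  by rewrite -!mulrA mulrCA (mulrA (zeta ^+ (q * n))) divff// mul1r mulrC.
have yE j Q : V (tauj j Q) -> y Q = (zeta ^+ j)^-1 * h (tauj j Q).
  move=> VQ; rewrite /y; case: pselect => [e|]; last by case; exists j.
  by case: cid => j' /= VQ'; exact: wd.
exists y => Q z Qz Dz.
have [Q' VQ' Q'z] := DV z Dz.
have [j Q'E] : exists j, Q' = tauj j Q by apply: quotient_coord_fiber; rewrite Qz.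
rewrite Q'E in VQ' Q'z.
have yEQ := yE _ _ VQ'; split.
- have c1 : {for Q, continuous (h \o tauj j)}.
    apply: continuous_comp; first exact: (iter_continuous rX ht).
    exact: (hV _ VQ').1.
  have c2 : {for Q, continuous (fun Q => (zeta ^+ j)^-1 * h (tauj j Q))}.
    exact: (@cvgM C X (nbhs Q) _ (fun=> (zeta ^+ j)^-1) (h \o tauj j) _ _ (cvg_cst _) c1).
  apply: continuous_near_eq c2.
  have : nbhs Q (tauj j @^-1` V).
    by apply: (iter_continuous rX ht); exact: open_nbhs_nbhs.
  by apply: filterS => Q'' VQ''; rewrite (yE j).
(* The exponent [p.-1] plays the role of -1, so [tau Q] is led to the same point of [V], and the
   prefactor changes by exactly [zeta]. *)
- have E : tauj (j + p.-1) (tau Q) = tauj j Q.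
    by rewrite -iterSr -addnS prednK// iterD taup.
  rewrite yEQ (yE (j + p.-1)%N); last by rewrite E.
  rewrite E mulrA; congr (_ * _).
  have zp : zeta ^+ p = 1 by exact: prim_expr_order.
  rewrite exprD invfM mulrC; congr (_ * _).
  have := zeta_neq0; rewrite -{1}(prednK p0) in zp => z0.
  by apply: (mulIf (znz p.-1)); rewrite mulVf// -exprS.
rewrite yEQ exprMn (hf _ _ VQ' Q'z) exprVn -exprM mulnC exprM.
by rewrite (prim_expr_order hz) expr1n invr1 mul1r.
Qed.

Lemma unbranched_local_root (f : C -> C) (z : C) :
  (forall Q, xi Q = Some z -> ~ branched_point (@orbit_proj R X tau) Q) ->
  (forall x, branched_point (@orbit_proj R X tau) x ->
    exists n k, [/\ (n %| p)%N, coprime (p %/ n) k &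
      rotation_number p zeta tau x n k]) ->
  continuous f -> f z != 0 ->
  exists D, [/\ open D, D z & exists y, root_over tau xi p zeta f D y].
Proof.
move=> unb hbr fc fz.
have [h0 [U [oU [Uz hU]]]] := local_root p0 fz.
have [Q0 Qz0] := quotient_coord_surj (Some z).
have [c ac cQ] := cX.2 Q0.
have oW : open (f @^-1` U) by apply: open_comp => // w _; exact: fc.
have nW : nbhs Q0 [set Q | exists2 z', xi Q = Some z' & U (f z')].
  by apply: (quotient_coord_cont Qz0); exact: open_nbhs_nbhs.
have [V VN [oV VQ _ Vrot Vdiv]] :=
  unbranched_disc rX ht hp hbr (unb _ Qz0) (cX.1 _ ac) cQ nW.
have nD : \forall z' \near z, exists2 Q, V Q & xi Q = Some z'.
  by apply: (quotient_coord_open Qz0); exact: open_nbhs_nbhs.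
pose D := [set z' | exists2 Q, V Q & xi Q = Some z']°.
exists D; split; [exact: open_interior|exact: nD|].
apply: (@root_over_orbit f p V (fun Q => h0 (f (quotient_val Q)))) => //.
- by move=> Q /Vrot[].
- move=> Q VQ'; have [z' Qz' Uz'] := VN _ VQ'; split.
    have c2 : {for Q, continuous (f \o quotient_val)}.
      by apply: (@continuous_comp X C C quotient_val f Q (quotient_val_continuous Qz')); exact: fc.
    apply: (@continuous_comp X C C (f \o quotient_val) h0 Q c2).
    rewrite /= (quotient_valE Qz'); exact: (hU _ Uz').2.
  by rewrite /quotient_val quotient_coord_iter_tau prim_expr_order// mul1r.
- move=> Q z' VQ' Qz'; have [z'' Qz'' Uz''] := VN _ VQ'.
  by move: Qz''; rewrite Qz' => -[E]; rewrite (quotient_valE Qz') E (hU _ Uz'').1.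
by move=> z' /interior_subset.
Qed.

(** Read in the chart [d], [Psi] is a function [G] whose local inverse is differentiable, so its
    derivative at 0 is nonzero; [q] is the difference quotient of [G] at 0. *)
Lemma local_parameter (d : chart R (orbit_space tau)) (u0 : orbit_space tau) (a : C) :
  atlas (orbit_space tau) d -> cdom d u0 -> cmap d u0 = 0 -> Psi u0 = Some a ->
  exists q : C -> C, q 0 != 0 /\ forall u z, cdom d u -> Psi u = Some z ->
    z - a = cmap d u * q (cmap d u) /\ {for cmap d u, continuous q}.
Proof.
move=> ad du0 du00 Psi0.
case: hPsi => hP hPh PsiK PhiK.
have hd : is_chart d by case: ad.
pose G : C -> C := cmap (sphere_chart0 R) \o Psi \o cinv d.
pose H : C -> C := cmap d \o Phi \o cinv (sphere_chart0 R).
have GE u z : cdom d u -> Psi u = Some z -> G (cmap d u) = z.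
  by move=> du Pu; rewrite /G /= (chart_cinvK hd du) Pu.
have dG u z : cdom d u -> Psi u = Some z -> derivable G (cmap d u) 1.
  move=> du Pu; have [_] := hP u; apply => //; first by left.
  by rewrite /= Pu.
have G0 : G 0 = a by rewrite -du00; exact: GE.
have dG0 : derivable G 0 1 by rewrite -du00; exact: dG Psi0.
have dH : derivable H (G 0) 1.
  have [_ h] := hPh (Some a).
  have Phia : Phi (Some a) = u0 by rewrite -Psi0 PsiK.
  rewrite G0; apply: (h (sphere_chart0 R) d) => //; first by left.
  by rewrite Phia.
have HG : {near (0 : C), H \o G =1 id}.
  have h1 : \forall z \near (0 : C), cdom d (cinv d z) /\ cmap d (cinv d z) = z.
    by rewrite -du00; exact: chart_near_inv.
  have h2 : \forall z \near (0 : C), Psi (cinv d z) <> None.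
    rewrite -du00.
    suff : nbhs (cmap d u0) (cinv d @^-1` [set u | Psi u <> None]) by [].
    apply: (chart_cinv_at hd du0).
    rewrite (chart_cinvK hd du0); have [cP _] := hP u0.
    apply: (cP [set w | w <> None]); rewrite Psi0.
    have : nbhs a [set: C] by exact: filterT.
    move=> /one_point_compactification_some_nbhs.
    by apply: filterS => _ [w _ <-].
  move: h1 h2; apply: filterS2 => z [dz Ez]; rewrite /H /G /=.
  case E: (Psi (cinv d z)) => [w|//] _.
  by rewrite -E PsiK.
exists (diff_quotient G 0); split.
  by rewrite /diff_quotient eqxx; exact: (derive_local_inverse_neq0 dG0 dH HG).
move=> u z du Pu; split.
  by have := diff_quotientP G 0 (cmap d u); rewrite subr0 G0 (GE _ _ du Pu).
have [->|sz] := eqVneq (cmap d u) 0; first exact: (diff_quotient_continuous dG0).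
apply: (diff_quotient_continuous_neq _ sz).
by have := dG _ _ du Pu; move/derivable1_diffP/differentiable_continuous.
Qed.

Lemma branched_local_root (f g : C -> C) (P : X) (a : C) (n k m : nat) :
  xi P = Some a -> rotation_number p zeta tau P n k ->
  (0 < m)%N -> gcdn p m = n -> (k * (m %/ n) = 1 %[mod p %/ n])%N ->
  (forall z, f z = (z - a) ^+ m * g z) -> continuous g -> g a != 0 ->
  exists D, [/\ open D, D a & exists y, root_over tau xi p zeta f D y].
Proof.
move=> Pa [n0 Pn Pmin _ [c [hc cP cP0 cn rot]]] m0 hn hk hf gc ga.
have np : (n %| p)%N by rewrite -hn dvdn_gcdl.
have nm : (n %| m)%N by rewrite -hn dvdn_gcdr.
set e := (p %/ n)%N in hk *.
have e0 : (0 < e)%N by rewrite divn_gt0// dvdn_leq.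
have co : coprime e k.
  have : coprime e (k * (m %/ n)) by rewrite -coprime_modr hk coprime_modr coprimen1.
  by rewrite coprimeMr => /andP[].
set w := (zeta ^+ n) ^+ k in rot.
have hw : e.-primitive_root w by exact: (rotation_root hz np co).
have we : w ^+ e = 1 by exact: prim_expr_order.
(* Since (zeta^n)^e = 1, the exponent k (m / n) matters only modulo [e], where it is 1. *)
have wm : w ^+ (m %/ n) = zeta ^+ n.
  have ze : (zeta ^+ n) ^+ e = 1 by rewrite -exprM mulnC divnK// prim_expr_order.
  by rewrite /w -exprM -(expr_mod _ ze) hk (expr_mod _ ze) expr1.
have disc N : nbhs P N -> exists2 V, V `<=` N & rotation_disc tau c P n w V.
  exact: (branched_disc rX ht hz np co n0 Pmin hc.1 cP cP0 cn rot).
have [V0 _ [oV0 V0P V0c V0rot V0div]] := disc _ filterT.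
have [d [ad dd dE]] := quotient_chart rX ht hp hc e0 hw oV0 V0c V0rot V0div.
rewrite cP0 in dE V0rot.
pose t : X -> C := cmap c.
have tP : t P = 0 by [].
have {}dE Q : V0 Q -> cmap d (pi Q) = t Q ^+ e by move=> /dE; rewrite subr0.
have {}V0rot Q : V0 Q -> V0 (tauj n Q) /\ t (tauj n Q) = w * t Q.
  by move=> /V0rot; rewrite !subr0.
have dP : cdom d (pi P) by rewrite dd; exists P.
have dP0 : cmap d (pi P) = 0 by rewrite dE// tP expr0n (gtn_eqF e0).
have [q [q0 hq]] := local_parameter ad dP dP0 Pa.
(* This is f(x) with the factor t^(e m) removed: nonzero at [P] and invariant under tau^n. *)
pose A (Q : X) : C := q (t Q ^+ e) ^+ m * g (quotient_val Q).
have tc Q : V0 Q -> {for Q, continuous t}.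
  by move=> VQ; exact: (chart_cmap_at hc.1 (V0c _ VQ)).
have Ac Q z : V0 Q -> xi Q = Some z -> {for Q, continuous A}.
  move=> VQ Qz; have [|_] := hq (pi Q) z _ Qz; first by rewrite dd; exists Q.
  rewrite (dE _ VQ) => qc.
  have c1 : {for Q, continuous (q \o (fun Q => t Q ^+ e))}.
    apply: (@continuous_comp X C C (fun Q => t Q ^+ e) q Q _ qc).
    exact: (@cvg_pow C X (nbhs Q) _ t _ e (tc _ VQ)).
  have c2 : {for Q, continuous (g \o quotient_val)}.
    by apply: (@continuous_comp X C C quotient_val g Q (quotient_val_continuous Qz)); exact: gc.
  exact: (@cvgM C X (nbhs Q) _ _ _ _ _ (@cvg_pow C X (nbhs Q) _ _ _ m c1) c2).
have A0 : A P != 0.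
  by rewrite /A tP expr0n (gtn_eqF e0) (quotient_valE Pa) mulf_neq0// expf_neq0.
have [h0 [U [oU [UA hU]]]] := local_root p0 A0.
have nN : nbhs P (V0 `&` [set Q | exists2 z, xi Q = Some z & setT z] `&` A @^-1` U).
  apply: filterI; first apply: filterI.
  - exact: open_nbhs_nbhs.
  - by apply: (quotient_coord_cont Pa); exact: filterT.
  by apply: (Ac _ _ V0P Pa); exact: open_nbhs_nbhs.
(* A second, smaller disc: inside [V0] the quotient chart is already known, and on [V] the values of
   [A] stay where the root [h0] is defined. *)
have [V VN [oV VP _ Vrot Vdiv]] := disc _ nN.
have nD : \forall z \near a, exists2 Q, V Q & xi Q = Some z.
  by apply: (quotient_coord_open Pa); exact: open_nbhs_nbhs.
exists ([set z | exists2 Q, V Q & xi Q = Some z]°).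
split; [exact: open_interior|exact: nD|].
apply: (@root_over_orbit f n V (fun Q => t Q ^+ (m %/ n) * h0 (A Q))) => //.
- by move=> Q /Vrot[].
- move=> Q VQ; have [[V0Q [z Qz _]] UQ] := VN _ VQ; split.
    have c1 : {for Q, continuous (h0 \o A)}.
      exact: (@continuous_comp X C C A h0 Q (Ac _ _ V0Q Qz) (hU _ UQ).2).
    exact: (@cvgM C X (nbhs Q) _ _ _ _ _
      (@cvg_pow C X (nbhs Q) _ t _ (m %/ n) (tc _ V0Q)) c1).
  have [_ tn] := V0rot _ V0Q.
  rewrite /A /quotient_val quotient_coord_iter_tau tn !exprMn we mul1r wm.
  by rewrite -mulrA.
- move=> Q z VQ Qz; have [[V0Q _] UQ] := VN _ VQ.
  have [|zE _] := hq (pi Q) z _ Qz; first by rewrite dd; exists Q.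
  rewrite exprMn (hU _ UQ).1 hf zE (dE _ V0Q) /A (quotient_valE Qz) exprMn mulrA.
  (* The powers of t agree because (p / n) m = (m / n) p. *)
  congr (_ * _ * _); rewrite -!exprM; congr (_ ^+ _).
  rewrite mulnC -{1}(divnK np) -mulnA; congr (_ * _)%N.
  by rewrite mulnC divnK.
by move=> z /interior_subset.
Qed.

End CyclicCover.

(** * The curve *)

Lemma set_type_nbhs (T : topologicalType) (A : set T) (s : set_type A) U :
  nbhs s U -> exists2 V, nbhs (set_val s) V & (set_val : set_type A -> T) @^-1` V `<=` U.
Proof.
rewrite nbhsE => -[W [[V oV VW] Ws] WU]; exists V.
  have Vs : V (set_val s) by move: Ws; rewrite -VW.
  by exists V; first by split.
by move=> x Vx; apply: WU; rewrite -VW.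
Qed.

Section CyclicPoly.
Variables (R : realType) (p r : nat) (a : 'I_r -> cplx R) (m : 'I_r -> nat).
Local Notation C := (cplx R).
Hypothesis p0 : (0 < p)%N.
Hypothesis hm : forall i, (0 < m i < p)%N.
Local Notation F := (cyclic_poly p a m).

Definition branch_poly (z : C) : C := \prod_(i < r) (z - a i) ^+ m i.

Lemma eval2_cyclic x y : eval2 F x y = y ^+ p - branch_poly x.
Proof.
rewrite /eval2 /cyclic_poly /branch_poly !hornerE horner_prod; congr (_ - _).
by apply: eq_bigr => i _; rewrite !hornerE.
Qed.

Lemma eval2_deriv_cyclic x y : eval2 F^`() x y = y ^+ p.-1 *+ p.
Proof.
rewrite /eval2 /cyclic_poly derivB derivXn derivC subr0 hornerMn hornerXn.
by rewrite -polyC_exp hornerMn hornerC.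
Qed.

Lemma branch_poly_eq0 z : (forall i, (0 < m i)%N) ->
  branch_poly z = 0 <-> range a z.
Proof.
move=> m0.
rewrite /branch_poly; split=> [/eqP|[i _ <-]].
  rewrite prodf_seq_eq0 => /hasP[i _ /=]; rewrite expf_eq0 subr_eq0.
  by case/andP=> _ /eqP ->; exists i.
by rewrite (bigD1 i)//= subrr expr0n gtn_eqF ?mul0r.
Qed.

Lemma branch_poly_continuous : continuous branch_poly.
Proof.
move=> z; apply: (@cvg_big_prod C C (nbhs z)) => i.
apply: (@cvg_pow C C (nbhs z)).
exact: (@cvgB C C C (nbhs z) _ id (fun=> a i) _ _ cvg_id (cvg_cst _)).
Qed.

Lemma affine_cyclicP x y :
  affine_set F (x, y) <-> y ^+ p = branch_poly x /\ branch_poly x != 0.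
Proof.
rewrite /affine_set /= eval2_cyclic eval2_deriv_cyclic /cyclic_poly.
rewrite lead_coefXnsubC// hornerC oner_eq0.
have E : (y ^+ p.-1 *+ p != 0) = (y ^+ p.-1 != 0) by rewrite mulrn_eq0 negb_or -lt0n p0.
rewrite E; split=> [[/eqP]|[h f0]].
  rewrite subr_eq0 => /eqP h y0 _; split=> //; apply/eqP => f0.
  have m0' i : (0 < m i)%N by case/andP: (hm i).
  (* A zero of f provides an index, hence 0 < m i < p and p is at least 2; then F_y = p y^(p-1)
     vanishes at y = 0. *)
  have [i _ _] := (branch_poly_eq0 x m0').1 f0; have /andP[m0 mp] := hm i.
  move: h; rewrite f0 => /eqP; rewrite expf_eq0 p0 /= => /eqP y00.
  by move: y0; rewrite y00 expr0n; case: (p) mp m0 => [|[|n]]//=; rewrite ?eqxx//; case: (m i).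
rewrite h subrr; split=> //; rewrite expf_neq0//.
by move: f0; rewrite -h expf_eq0 p0.
Qed.

End CyclicPoly.

(** * The regular locus of [X] as the affine curve, and irreducibility of its equation *)

Section Model.
Variables (R : realType) (X : cspace R) (tau : X -> X) (p : nat).
Local Notation C := (cplx R).
Local Notation tauj j := (iter j tau).
Local Notation pi := (@orbit_pi R X tau).
Hypothesis hX : compact_riemann_surface X.
Hypothesis ht : holomorphic tau.
Hypothesis hp : has_order tau p.
Variable zeta : C.
Hypothesis hz : p.-primitive_root zeta.
Variables (Psi : orbit_space tau -> sphere R) (Phi : sphere R -> orbit_space tau).
Hypothesis hPsi : inverse_isos Psi Phi.
Variables (r : nat) (a : 'I_r -> C) (m : 'I_r -> nat).
Hypothesis hm : forall i, (0 < m i < p)%N.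
Hypothesis hbr : forall x, branched_point (@orbit_proj R X tau) x ->
  exists n k, [/\ (n %| p)%N, coprime (p %/ n) k &
    rotation_number p zeta tau x n k].
Hypothesis hunb : forall Q z, quotient_coord Psi Q = Some z -> ~ range a z ->
  ~ branched_point (@orbit_proj R X tau) Q.
Variable y : X -> C.
Local Notation f := (branch_poly a m).
Hypothesis hy : root_over tau (quotient_coord Psi) p zeta f setT y.

Local Notation F := (cyclic_poly p a m).
Local Notation xi := (quotient_coord Psi).
Local Notation xval := (quotient_val Psi).

Let rX : riemann_surface X. Proof. by case: hX. Qed.
Let cX : charted X. Proof. exact: riemann_surface_charted. Qed.
Let p0 : (0 < p)%N. Proof. by case: hp. Qed.
Let m0 i : (0 < m i)%N. Proof. by case/andP: (hm i). Qed.

Definition regular (Q : X) : Prop := exists2 z, xi Q = Some z & f z != 0.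

Lemma quotient_coord_holomorphic : @holomorphic R X (sphere R) (xi : X -> sphere R).
Proof.
move=> Q; case: hPsi => hP _ _ _.
apply: (@cdiff_comp R X (orbit_space tau) (sphere R) (orbit_proj tau) Psi Q) => //.
- exact: (charted_orbit_space rX ht hp hz hbr).
- exact: orbit_proj_holomorphic.
Qed.

Lemma y_neq0 Q : regular Q -> y Q != 0.
Proof. by move=> [z Qz fz]; have [_ _ E] := hy Qz I; move: fz; rewrite -E expf_eq0 p0. Qed.

(** Equal x means equal orbit. The j-th iterate multiplies the nonzero y by zeta^j, so equal y
    forces p to divide j. *)
Lemma regular_inj Q Q' : regular Q -> xi Q = xi Q' -> y Q = y Q' -> Q = Q'.
Proof.
move=> rQ E yE; have [z Qz fz] := rQ; have [j Q'E] := quotient_coord_fiber hp hPsi E.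
move: yE; rewrite Q'E (root_over_iter (quotient_coord_tau hp Psi) j hy Qz I) => yE.
have : zeta ^+ j = 1.
  by apply: (mulIf (y_neq0 rQ)); rewrite -yE mul1r.
move=> /eqP; rewrite -(prim_order_dvd hz) => /dvdnP[q ->].
by rewrite (iter_mul_order hp).
Qed.

Lemma affine_exists (s : C * C) : affine_set F s ->
  exists Q, [/\ regular Q, xi Q = Some s.1 & y Q = s.2].
Proof.
case: s => x w /(affine_cyclicP a p0 hm)[hw fx] /=.
have [Q Qx] := quotient_coord_surj hPsi (Some x).
have [_ _ yp] := hy Qx I.
have rQ : regular Q by exists x.
have y0 := y_neq0 rQ.
have /(prim_rootP hz)[j jE] : (w / y Q) ^+ p = 1.
  by rewrite expr_div_n hw yp divff.
exists (tauj j Q); rewrite (quotient_coord_iter_tau hp); split => //.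
  by exists x => //; rewrite (quotient_coord_iter_tau hp).
by rewrite (root_over_iter (quotient_coord_tau hp Psi) j hy Qx I) -jE divfK.
Qed.

Lemma regular_affine Q : regular Q -> affine_set F (xval Q, y Q).
Proof.
move=> [z Qz fz]; rewrite (quotient_valE Qz); apply/(affine_cyclicP a p0 hm).
by have [_ _ ->] := hy Qz I.
Qed.

Lemma affine_point : exists s, affine_set F s.
Proof.
have fin : finite_set (range a) by apply: finite_image; exact: finite_finset.
have [|z [_ za]] := open_meets_cofinite (@openT C) _ fin; first by exists 0.
have fz : f z != 0 by apply/eqP => /(branch_poly_eq0 _ _ m0).
have [Q Qz] := quotient_coord_surj hPsi (Some z).
by exists (xval Q, y Q); apply: regular_affine; exists z.
Qed.

(** The embedding [iota] of the affine curve into its model [X]. *)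
Definition curve_inv (s : affine_curve F) : X :=
  projT1 (cid (affine_exists (set_valP s))).

Lemma curve_invP s : [/\ regular (curve_inv s),
  xi (curve_inv s) = Some (affine_pt s).1 & y (curve_inv s) = (affine_pt s).2].
Proof. by rewrite /curve_inv; case: cid. Qed.

Definition to_curve (Q : X) : affine_curve F :=
  if pselect (affine_set F (xval Q, y Q)) is left h
  then SigSub (mem_set h)
  else SigSub (mem_set (projT2 (cid affine_point))).

Lemma to_curveE Q : regular Q -> affine_pt (to_curve Q) = (xval Q, y Q).
Proof.
by move=> /regular_affine h; rewrite /to_curve; case: pselect.
Qed.

Lemma affine_pt_inj : injective (@affine_pt R F).
Proof. exact: val_inj. Qed.

Lemma curve_invK : cancel curve_inv to_curve.
Proof.
move=> s; have [rs sx sy] := curve_invP s; apply: affine_pt_inj.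
by rewrite to_curveE// (quotient_valE sx) sy -surjective_pairing.
Qed.

Lemma to_curveK Q : regular Q -> curve_inv (to_curve Q) = Q.
Proof.
move=> rQ; have [rs sx sy] := curve_invP (to_curve Q).
apply: regular_inj => //.
  by rewrite sx to_curveE//=; case: rQ => z Qz _; rewrite (quotient_valE Qz).
by rewrite sy to_curveE.
Qed.

Lemma regular_near Q : regular Q -> \forall Q' \near Q, regular Q'.
Proof.
move=> [z Qz fz].
have : nbhs z [set w | f w != 0].
  exact: (@cvgr_neq0 C C C (nbhs z) _ f _ (@branch_poly_continuous R r a m z) fz).
move=> /(quotient_coord_cont hPsi Qz); apply: filterS => Q' [w ? ?]; by exists w.
Qed.

Lemma to_curve_continuous Q : regular Q -> {for Q, continuous to_curve}.
Proof.
move=> rQ W /set_type_nbhs[V].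
have -> : set_val (to_curve Q) = (xval Q, y Q) by exact: to_curveE.
move=> nV VW; have [z Qz _] := rQ; have [yc _ _] := hy Qz I.
have h : nbhs Q ((fun Q => (xval Q, y Q)) @^-1` V).
  exact: (cvg_pair (quotient_val_continuous hPsi Qz) yc nV).
move: h (regular_near rQ); apply: filterS2 => Q' VQ' rQ'.
by apply: VW; rewrite /preimage /= -/(affine_pt _) to_curveE.
Qed.

(** Openness of x yields a point near the given one with the prescribed x. Its y and the prescribed
    one are p-th roots of the same number lying in a set where the p-th power is injective, so it is
    the required point. *)
Lemma curve_inv_continuous : continuous curve_inv.
Proof.
move=> s W sW; have [rs sx sy] := curve_invP s.
have [B nB injB] := pow_inj_nbhs p0 (y_neq0 rs).
have [yc _ _] := hy sx I.
have n1 : nbhs (curve_inv s) (W `&` y @^-1` B) by apply: filterI => //; exact: yc.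
have n2 := quotient_coord_open rX ht hp hPsi sx n1.
have c : {for s, continuous (@affine_pt R F)} by exact: initial_continuous.
have c1 : {for s, continuous (fst \o @affine_pt R F)}.
  by apply: (@continuous_comp (affine_T F) (C * C)%type C (@affine_pt R F) fst s c); exact: cvg_fst.
have c2 : {for s, continuous (snd \o @affine_pt R F)}.
  by apply: (@continuous_comp (affine_T F) (C * C)%type C (@affine_pt R F) snd s c); exact: cvg_snd.
have {}n2 : nbhs s ((fst \o @affine_pt R F) @^-1`
    [set z | exists2 Q, (W `&` y @^-1` B) Q & xi Q = Some z]).
  by apply: c1; exact: n2.
have n3 : nbhs s ((snd \o @affine_pt R F) @^-1` B) by apply: c2; rewrite /= -sy.
move: n2 n3; apply: filterS2 => s' [Q [WQ BQ] Qs'] Bs'.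
have [rs' sx' sy'] := curve_invP s'.
suff E : Q = curve_inv s' by rewrite /preimage /= -E.
apply/esym/regular_inj => //; first by rewrite sx' Qs'.
rewrite sy'; apply: injB => //.
have [_ _ ->] := hy Qs' I; rewrite -sy'.
by have [_ _ ->] := hy sx' I.
Qed.

Lemma regular_unbranched Q : regular Q -> ~ branched_point (@orbit_proj R X tau) Q.
Proof.
move=> [z Qz fz]; apply: (hunb Qz) => az; move: fz.
by have -> : f z = 0; [apply/(branch_poly_eq0 _ _ m0)|rewrite eqxx].
Qed.

Lemma curve_inv_holomorphic : holomorphic curve_inv.
Proof.
move=> s; split; first exact: curve_inv_continuous.
move=> c d [hc cx] ad cs ds.
have [rs sx sy] := curve_invP s; set Q0 := curve_inv s in ds rs sx sy *.
have hd := atlas_holo_chart rX ad.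
have [V _ [oV VQ Vd Vrot Vdiv]] :=
  unbranched_disc rX ht hp hbr (regular_unbranched rs) hd.1 ds filterT.
have [d' [ad' dd' d'E]] := quotient_chart rX ht hp hd (ltn0Sn 0) (prim_root1 C) oV Vd Vrot Vdiv.
case: hPsi => _ hPhi PsiK PhiK.
(* At an unbranched point the quotient chart, taken with exponent 1, is the chart [d] up to
   translation; hence [curve_inv] in coordinates is [Phi] read in [d'], shifted back. *)
pose k (z : C) : C := cmap d' (Phi (Some z)) + cmap d Q0.
have Phis : Phi (Some (affine_pt s).1) = pi Q0 by rewrite -sx /quotient_coord PsiK.
have dk : derivable k (cmap c s) 1.
  rewrite (cx _ cs); apply: derivableD; last exact: derivable_cst.
  have [_ h] := hPhi (Some (affine_pt s).1).
  apply: (h (sphere_chart0 R) d') => //; first by left.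
  by rewrite Phis dd'; exists Q0.
apply: near_eq_derivable dk.
have n1 := chart_near_inv hc cs.
have n2 : nbhs (cmap c s) (cinv c @^-1` (curve_inv @^-1` V)).
  apply: (chart_cinv_at hc cs); rewrite (chart_cinvK hc cs).
  by apply: curve_inv_continuous; exact: open_nbhs_nbhs.
move: n1 n2; apply: filterS2 => z [cz zE] Vz.
have [_ sx' _] := curve_invP (cinv c z).
rewrite -(cx _ cz) zE in sx'.
have -> : k z = cmap d' (pi (curve_inv (cinv c z))) + cmap d Q0.
  by rewrite /k -sx' /quotient_coord PsiK.
by rewrite d'E// expr1 subrK.
Qed.

Lemma to_curve_cdiff Q : regular Q -> @cdiff_at R X (affine_curve F) to_curve Q.
Proof.
move=> rQ; split; first exact: to_curve_continuous.
move=> c d ac [hd dx] cQ dQ.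
have [z Qz _] := rQ.
have [_ h] := quotient_coord_holomorphic Q.
have dxi : derivable (cmap (sphere_chart0 R) \o (xi : X -> sphere R) \o cinv c) (cmap c Q) 1.
  by apply: h => //; [left|rewrite /= Qz].
apply: near_eq_derivable dxi.
have n1 : nbhs Q (to_curve @^-1` cdom d).
  by apply: to_curve_continuous => //; exact: chart_nbhs.
have n2 : nbhs (cmap c Q) (cinv c @^-1` (to_curve @^-1` cdom d `&` regular)).
  apply: (chart_cinv_at (cX.1 _ ac) cQ); rewrite (chart_cinvK (cX.1 _ ac) cQ).
  by apply: filterI => //; exact: regular_near.
by move: n2; apply: filterS => w [dw rw] /=; rewrite dx// to_curveE.
Qed.

Lemma irregular_finite : finite_set (~` regular).
Proof.
pose S := [set None] `|` (Some @` range a).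
have fS : finite_set S.
  rewrite finite_setU; split; first exact: finite_set1.
  by do 2 apply: finite_image; exact: finite_finset.
apply: (@sub_finite_set _ _ (\bigcup_(w in S) [set Q | xi Q = w])).
  move=> Q nQ; exists (xi Q) => //.
  case E : (xi Q) => [z|]; last by left.
  right; exists z => //; apply/(branch_poly_eq0 _ _ m0)/eqP/negPn/negP => fz.
  by apply: nQ; exists z.
apply: bigcup_finite => // w _; have [Q Qw] := quotient_coord_surj hPsi w.
apply: (@sub_finite_set _ _ ((fun j => tauj j Q) @` `I_p)); last exact: finite_image.
move=> Q' Q'w; have [|j ->] := quotient_coord_fiber hp hPsi (Q := Q) (Q' := Q').
  by rewrite Qw.
exists (j %% p)%N; first by rewrite /= ltn_pmod.
by rewrite (iter_modn_order hp).
Qed.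

Lemma curve_surface : @is_surface_of R F X curve_inv.
Proof.
split => //.
- exact: curve_inv_holomorphic.
- exists to_curve; split; first exact: curve_invK.
  by move=> s; apply: to_curve_cdiff; case: (curve_invP s).
- apply: sub_finite_set irregular_finite; apply: subsetC => Q rQ.
  by exists (to_curve Q) => //; exact: to_curveK.
exists (xi : X -> sphere R); first exact: quotient_coord_holomorphic.
by move=> s; case: (curve_invP s).
Qed.

Lemma curve_inv_tau (s : affine_curve F) : exists2 s' : affine_curve F,
  affine_pt s' = ((affine_pt s).1, zeta * (affine_pt s).2) &
  tau (curve_inv s) = curve_inv s'.
Proof.
have [[z Qz fz] sx sy] := curve_invP s.
have rt : regular (tau (curve_inv s)) by exists z => //; rewrite (quotient_coord_tau hp).
exists (to_curve (tau (curve_inv s))); last by rewrite to_curveK.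
have [_ yt _] := hy sx I.
by rewrite to_curveE// (quotient_valE (z := (affine_pt s).1)) ?(quotient_coord_tau hp)// yt sy.
Qed.

Lemma regular_connected : connected regular.
Proof.
have -> : regular = setT `\` (~` regular) by rewrite setTD setCK.
case: (rX) => hausX [conX _] _ _ _.
apply: connected_setD_finite => //; first exact: openT.
  exact: irregular_finite.
by move=> x _; exact: surface_locally_punctured_connected.
Qed.

Lemma eval2_continuous (G : {poly {poly C}}) Q : regular Q ->
  {for Q, continuous (fun Q => eval2 G (xval Q) (y Q))}.
Proof.
move=> [z Qz _]; have [yc _ _] := hy Qz I.
have E x w : eval2 G x w = \sum_(i < size G) (G`_i).[x] * w ^+ i.
  rewrite /eval2 (horner_coef G) horner_sum; apply: eq_bigr => i _.
  by rewrite hornerM -polyC_exp hornerC.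
rewrite /prop_for /continuous_at E; under eq_fun do rewrite E.
apply: (@cvg_big_sum C X (nbhs Q)) => i.
apply: (@cvgM C X (nbhs Q)).
  exact: (@cvg_horner C X (nbhs Q) _ _ _ _ (quotient_val_continuous hPsi Qz)).
exact: (@cvg_pow C X (nbhs Q) _ _ _ i yc).
Qed.

Lemma eval2M (G H : {poly {poly C}}) x w : eval2 (G * H) x w = eval2 G x w * eval2 H x w.
Proof. by rewrite /eval2 !hornerM. Qed.

Lemma eval2D (G H : {poly {poly C}}) x w : eval2 (G + H) x w = eval2 G x w + eval2 H x w.
Proof. by rewrite /eval2 !hornerD. Qed.

(** Over one regular value of x the p distinct numbers zeta^i y are roots of the specialisation of
    [G], which is nonzero because it divides that of [F]. *)
Lemma factor_degree (G : {poly {poly C}}) :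
  (forall Q, regular Q -> eval2 G (xval Q) (y Q) = 0) ->
  (exists H, F = G * H) -> (p < size G)%N.
Proof.
move=> G0 [H FGH].
have [s hs] := affine_point; have [Q [rQ Qx ys]] := affine_exists hs.
set x := s.1 in Qx.
pose g : {poly C} := map_poly (horner_eval x) G.
have gE w : g.[w] = eval2 G x w.
  rewrite /eval2 /g -[w in LHS](hornerC w x) -[(w%:P).[x]]/(horner_eval x w%:P).
  by rewrite horner_map.
have g0 : g != 0.
  apply/eqP => g0; have F0 w : eval2 F x w = 0.
    by rewrite FGH eval2M -gE g0 horner0 mul0r.
  (* The values -f(x) and 1 - f(x) cannot both vanish. *)
  have := F0 0; have := F0 1; rewrite !eval2_cyclic => /eqP.
  rewrite expr1n expr0n (gtn_eqF p0) subr_eq0 => /eqP <-.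
  by move/eqP; rewrite sub0r oppr_eq0 oner_eq0.
have sg : (size g <= size G)%N by exact: size_poly.
apply: leq_trans sg.
pose rs := [seq zeta ^+ (i : 'I_p) * y Q | i <- enum 'I_p].
have szrs : size rs = p by rewrite size_map size_enum_ord.
rewrite -[in X in (X < _)%N]szrs; apply: max_poly_roots => //.
  apply/allP => _ /mapP[i _ ->]; apply/rootP; rewrite gE.
  rewrite -(root_over_iter (quotient_coord_tau hp Psi) i hy Qx I).
  have Qi : xi (tauj i Q) = Some x by rewrite (quotient_coord_iter_tau hp).
  rewrite -{1}(quotient_valE Qi) G0//.
  by case: rQ => z Qz fz; exists z => //; rewrite (quotient_coord_iter_tau hp).
rewrite map_inj_uniq ?enum_uniq// => i j /(mulIf (y_neq0 rQ)) /eqP.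
by rewrite (eq_prim_root_expr hz) !modn_small// => /eqP/val_inj.
Qed.

(* F is separable on the regular locus, so exactly one of two factors
   vanishes at each point, and the locus is connected. *)
Lemma irreducible_cyclic : irreducible2 F.
Proof.
have szF : size F = p.+1 by rewrite size_XnsubC.
have lcF : lead_coef F = 1 by rewrite lead_coefXnsubC.
have F0 : F != 0 by rewrite -size_poly_eq0 szF.
split=> //.
  by rewrite poly_unitE szF eqSS (gtn_eqF p0).
(* A factor vanishing on the whole locus has degree at least p in y, so the cofactor is constant in
   y; since [F] is monic, this constant is invertible in C[x]. *)
have unit_factor (G H : {poly {poly C}}) : F = G * H ->
    (forall Q, regular Q -> eval2 G (xval Q) (y Q) = 0) -> H \is a GRing.unit.
  move=> FGH hG.
  have pG : (p < size G)%N by apply: factor_degree => //; exists H.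
  have [G0 H0] : G != 0 /\ H != 0 by apply/andP; rewrite -negb_or -mulf_eq0 -FGH.
  have szH : size H = 1%N.
    have := size_mul G0 H0; rewrite -FGH szF.
    have : (0 < size H)%N by rewrite lt0n size_poly_eq0.
    by move: pG; case: (size G) (size H) => [//|g] [//|h]; rewrite addSn /=; lia.
  rewrite poly_unitE szH eqxx /=.
  have lcH : lead_coef G * H`_0 = 1.
    by rewrite -lcF FGH lead_coefM [lead_coef H]lead_coefE szH.
  by apply/unitrP; exists (lead_coef G); split => //; rewrite mulrC.
move=> G H FGH.
have FQ Q : regular Q -> eval2 G (xval Q) (y Q) * eval2 H (xval Q) (y Q) = 0.
  by move=> /regular_affine[+ _ _]; rewrite -eval2M -FGH.
have sep Q : regular Q -> eval2 G (xval Q) (y Q) = 0 -> eval2 H (xval Q) (y Q) = 0 -> False.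
  move=> /regular_affine[_ + _] hG hH; rewrite FGH derivM eval2D !eval2M /= hG hH.
  by rewrite mulr0 mul0r addr0 eqxx.
pose V (G : {poly {poly C}}) := [set Q | eval2 G (xval Q) (y Q) != 0].
have openV (G' : {poly {poly C}}) : open (regular `&` V G').
  rewrite openE => Q [rQ VQ].
  have n1 : nbhs Q (V G').
    exact: (@cvgr_neq0 C C X (nbhs Q) _ _ _ (@eval2_continuous G' Q rQ) VQ).
  by have := regular_near rQ; rewrite /interior; move: n1; apply: filterS2.
have closedV (G' H' : {poly {poly C}}) : (forall Q, regular Q -> 
    eval2 G' (xval Q) (y Q) * eval2 H' (xval Q) (y Q) = 0) ->
    (forall Q, regular Q -> eval2 G' (xval Q) (y Q) = 0 -> eval2 H' (xval Q) (y Q) = 0 -> False) ->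
    regular `&` V H' = regular `&` ~` (regular `&` V G').
  move=> h1 h2; apply/seteqP; split => Q [rQ].
    move=> HQ; split => // -[_ GQ].
    by have /eqP := h1 Q rQ; rewrite mulf_eq0 (negbTE HQ) (negbTE GQ).
  move=> nG; split => //; apply/negP => /eqP HQ; apply: nG; split => //.
  by apply/negP => /eqP GQ; exact: h2 Q rQ GQ HQ.
have [[Q [rQ VQ]]|nV] := pselect ((regular `&` V H) !=set0).
  right; apply: (unit_factor G) => // Q' rQ'.
  have E : regular `&` V H = regular.
    apply: regular_connected; first by exists Q.
      exists (regular `&` V H); first exact: openV.
      by rewrite setIA setIid.
    exists (~` (regular `&` V G)); first by apply: open_closedC; exact: openV.
    exact: closedV.
  have [_ VQ'] : (regular `&` V H) Q' by rewrite E.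
  by have /eqP := FQ Q' rQ'; rewrite mulf_eq0 (negbTE VQ') orbF => /eqP.
left; apply: (unit_factor H); first by rewrite mulrC.
move=> Q rQ; apply/eqP/negPn/negP => VQ; apply: nV; by exists Q.
Qed.

End Model.

(** * The equation of [X] and the action of [tau] on it *)

Theorem theorem1p6 (R : realType)
    (X : cspace R) (hX : compact_riemann_surface X)
    (tau : X -> X) (htau : isomorphism tau)
    (p : nat) (hp : has_order tau p)
    (zeta : cplx R) (hzeta : p.-primitive_root zeta)
    (hgenus : has_genus (orbit_space tau) 0)
    (r : nat) (n k m : 'I_r -> nat)
    (P : forall i : 'I_r, 'I_(n i) -> X)
    (hPbranch : [set x | branched_point (@orbit_proj R X tau) x]
                = \bigcup_(i in [set: 'I_r]) range (P i))
    (hPinj : forall i, injective (P i))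
    (hPorbit : forall i, exists x, range (P i) = iorbit tau x)
    (hPdistinct : forall i j, i <> j -> range (P i) <> range (P j))
    (hrot : forall i l, rotation_number p zeta tau (P i l) (n i) (k i))
    (hm : forall i, [/\ (1 <= m i < p)%N, gcdn p (m i) = n i
                      & k i * (m i %/ n i) = 1 %[mod p %/ n i]])
    (Psi : orbit_space tau -> sphere R) (hPsi : isomorphism Psi)
    (a : 'I_r -> cplx R)
    (ha : forall i l, Psi (orbit_proj tau (P i l)) = Some (a i)) :
  let F := cyclic_poly p a m in
  is_equation F X /\
  exists (Y : cspace R) (iota : affine_curve F -> Y)
         (Phi : X -> Y) (Phi' : Y -> X),
    [/\ is_surface_of iota,
        inverse_isos Phi Phi'
      & forall s : affine_curve F, exists2 s' : affine_curve F,
          affine_pt s' = ((affine_pt s).1, zeta * (affine_pt s).2) &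
          Phi (tau (Phi' (iota s))) = iota s'].
Proof.
have rX : riemann_surface X by case: hX.
have ht : holomorphic tau by case: htau => ? [].
have [Phi hPsi'] := hPsi.
have p0 : (0 < p)%N by case: hp.
have m0 i : (0 < m i)%N by case: (hm i) => /andP[].
have hm' i : (0 < m i < p)%N by case: (hm i).
have np i : (n i %| p)%N by have [_ <- _] := hm i; exact: dvdn_gcdl.
have n0 i : (0 < n i)%N by rewrite (dvdn_gt0 p0).
have xiP i l : quotient_coord Psi (P i l) = Some (a i) by exact: ha.
have brP x : branched_point (@orbit_proj R X tau) x -> exists i l, x = P i l.
  have E := hPbranch; move=> bx.
  have : [set x | branched_point (@orbit_proj R X tau) x] x by [].
  by rewrite E => -[i _ [l _ <-]]; exists i, l.
have co i : coprime (p %/ n i) (k i).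
  have [_ _ hk] := hm i.
  have : coprime (p %/ n i) (k i * (m i %/ n i))%N.
    by rewrite -coprime_modr hk coprime_modr coprimen1.
  by rewrite coprimeMr => /andP[].
(* Distinct orbits have distinct images under [Psi]; this makes the product of the other factors
   nonzero at [a i]. *)
have ainj : injective a.
  move=> i j aij; apply: contrapT => /hPdistinct; apply.
  pose u := P i (Ordinal (n0 i)); pose v := P j (Ordinal (n0 j)).
  have range_iorbit i' l : range (P i') = iorbit tau (P i' l).
    have [x hx] := hPorbit i'; rewrite hx.
    have : range (P i') (P i' l) by exists l.
    rewrite hx => -[t _ xt]; apply/(orbit_pi_iorbit tau)/(orbit_pi_eq hp).
    by exists t.
  rewrite (range_iorbit i (Ordinal (n0 i))) (range_iorbit j (Ordinal (n0 j))).
  apply/(orbit_pi_iorbit tau)/(orbit_pi_eq hp).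
  by apply: (quotient_coord_fiber hp hPsi'); rewrite !xiP aij.
have hbr x : branched_point (@orbit_proj R X tau) x -> exists n k,
    [/\ (n %| p)%N, coprime (p %/ n) k & rotation_number p zeta tau x n k].
  by move=> /brP[i [l ->]]; exists (n i), (k i); split.
have hunb Q z : quotient_coord Psi Q = Some z -> ~ range a z ->
    ~ branched_point (@orbit_proj R X tau) Q.
  move=> Qz az /brP[i [l QE]]; apply: az; exists i => //.
  by move: Qz; rewrite QE xiP => -[].
have [y hy] : exists y, root_over tau (quotient_coord Psi) p zeta (branch_poly a m) setT y.
  apply: (@root_over_plane R X tau (quotient_coord Psi) p zeta (branch_poly a m) (range a)) => //.
  - by apply: finite_image; exact: finite_finset.
  - by move=> z az; apply/eqP => /(branch_poly_eq0 _ _ m0).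
  - by move=> z az; apply/(branch_poly_eq0 _ _ m0).
  - by move=> z; exact: (quotient_coord_surj hPsi').
  - by move=> Q; exact: (quotient_coord_tau hp).
  - by move=> Q Q'; exact: (quotient_coord_fiber hp hPsi').
  - by move=> Q z W; exact: (quotient_coord_cont hPsi').
  - by move=> Q z U; exact: (quotient_coord_open rX ht hp hPsi').
  move=> z; have [[i _ <-]|az] := pselect (range a z); last first.
    apply: (unbranched_local_root rX ht hp hzeta hPsi' _ hbr).
    - by move=> Q Qz; exact: hunb Qz az.
    - exact: branch_poly_continuous.
    - by apply/eqP => /(branch_poly_eq0 _ _ m0).
  have [_ hn hk] := hm i.
  pose g (z : cplx R) := \prod_(j < r | j != i) (z - a j) ^+ m j.
  apply: (@branched_local_root _ _ _ _ rX ht hp _ hzeta _ _ hPsi' _ g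
    (P i (Ordinal (n0 i))) _ (n i) (k i) (m i)) => //.
  - by move=> w; rewrite /branch_poly (bigD1 i).
  - move=> w; apply: (@cvg_big_prod _ _ (nbhs w)) => j.
    apply: (@cvg_pow _ _ (nbhs w)).
    exact: (@cvgB _ _ _ (nbhs w) _ id (fun=> a j) _ _ cvg_id (cvg_cst _)).
  - apply/prodf_neq0 => j ji; rewrite expf_neq0// subr_eq0.
    by apply: contra ji => /eqP/ainj ->.
have model := curve_surface hX ht hp hzeta hPsi' hm' hbr hunb hy.
have idX : inverse_isos (@id X) id by split=> // x; exact: cdiff_id.
split.
  split.
  - by rewrite size_XnsubC// ltnS.
  - exact: (irreducible_cyclic hX hp hzeta hPsi' hm' hy).
  - exists X, (@curve_inv _ _ _ _ hp _ hzeta _ _ hPsi' _ _ _ hm' _ hy); split; first exact: model.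
    by exists id; exists id.
exists X, (@curve_inv _ _ _ _ hp _ hzeta _ _ hPsi' _ _ _ hm' _ hy), id, id; split => // s.
exact: curve_inv_tau.
Qed.
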